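(* Let $X$ be a one-dimensional, continuous, regular, strong Markov process with state space an open interval $E\subset\mathbb{R}$, in the precise sense described in the context. Let $\xi\in E$ and $z\in E$. Then for all $\varepsilon>0$ we have $\mathsf{P}_\xi(\boldsymbol{\tau}_z<\varepsilon)>0$, where $\boldsymbol{\tau}_z=\inf\{t\ge 0: X_t=z\}$.
   Context: Setting: $E=(a,b)$ with $-\infty\le a<b\le\infty$ is an open interval of $\mathbb{R}$, and $\overline E$ is its closure (in the extended real line $[-\infty,\infty]$). $X=(X_t)_{t\ge0}$ is a one-dimensional (time-homogeneous) Markov process with state space $E$ on a filtered measurable space $(\Omega,\mathscr{F},\mathfrak{F})$, together with a family of probability measures $(\mathsf{P}_\xi)_{\xi\in\overline E}$, where under $\mathsf{P}_\xi$ the process starts at $\xi$. The death-time of $X$ is denoted $\boldsymbol{\zeta}$. It is assumed that: $X$ is strong Markov; $X$ is continuous on $[0,\boldsymbol{\zeta})$; on $\{\boldsymbol{\zeta}<\infty\}$ the limit $\lim_{t\nearrow\boldsymbol{\zeta}}X_t$ exists and does not lie in $E$ (so it lies in $\overline E\setminus E$), and $X_{\boldsymbol{\zeta}+s}:=\lim_{t\nearrow\boldsymbol{\zeta}}X_t\in\overline E$ for all $s\ge0$ on $\{\boldsymbol{\zeta}<\infty\}$; and $X$ is regular, that is, with $\boldsymbol{\tau}_z=\inf\{t\ge0:X_t=z\}$ for $z\in\overline E$ (and $\inf\emptyset=\infty$), $\mathsf{P}_\xi(\boldsymbol{\tau}_z<\infty)>0$ for all $\xi,z\in E$. *)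

(* Defs.v *)
From HB Require Import structures.
From mathcomp Require Import all_boot all_order all_algebra.
From mathcomp Require Import all_classical all_reals all_analysis.
From mathcomp Require Import measurable_realfun.

Set Implicit Arguments.
Unset Strict Implicit.
Unset Printing Implicit Defensive.

Import Order.TTheory GRing.Theory Num.Theory.
Import numFieldTopology.Exports numFieldNormedType.Exports.

Local Open Scope classical_set_scope.
Local Open Scope ring_scope.

(* Time is indexed by [R], but only the times [0 <= t] are ever constrained.
   Processes take values in [\bar R], the ambient space of the closure of E. *)

Definition state_space (R : realType) (a b : \bar R) : set R :=
  [set x | (a < x%:E)%E /\ (x%:E < b)%E].

Definition closed_state_space (R : realType) (a b : \bar R) : set (\bar R) :=
  closure (EFin @` state_space a b).

Definition hitting_time (R : realType) (T : Type) (X : R -> T -> \bar R)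
    (z : \bar R) (w : T) : \bar R :=
  ereal_inf (EFin @` [set t : R | 0 <= t /\ X t w = z]).

(* As X is absorbed outside E, its death-time is the first exit time of E. *)
Definition death_time (R : realType) (a b : \bar R) (T : Type)
    (X : R -> T -> \bar R) (w : T) : \bar R :=
  ereal_inf
    (EFin @` [set t : R | 0 <= t /\ ~ (EFin @` state_space a b) (X t w)]).

Section Filtrations.
Context {R : realType} {d : measure_display} {T : measurableType d}.
Implicit Types (F : R -> set (set T)) (tau : T -> \bar R).

Record filtration F : Prop := {
  filtration_sigma_algebra : forall t : R, 0 <= t -> sigma_algebra setT (F t) ;
  filtration_sub : forall t : R, 0 <= t -> F t `<=` measurable ;
  filtration_le : forall s t : R, 0 <= s -> s <= t -> F s `<=` F t }.

Definition adapted F (X : R -> T -> \bar R) : Prop :=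
  forall t : R, 0 <= t -> forall B : set (\bar R), measurable B ->
    F t (X t @^-1` B).

Definition stopping_time F tau : Prop :=
  (forall w, 0 <= tau w)%E /\
  (forall t : R, 0 <= t -> F t [set w | (tau w <= t%:E)%E]).

(* The sigma-algebra of events prior to [tau]. *)
Definition stopped_sigma_algebra F tau : set (set T) :=
  [set A | measurable A /\
    forall t : R, 0 <= t -> F t (A `&` [set w | (tau w <= t%:E)%E])].

End Filtrations.

(* The product sigma-algebra on paths, generated by the coordinates t >= 0. *)
Definition path_events (R : realType) : set (set (R -> \bar R)) :=
  <<s [set C | exists t : R, exists B : set (\bar R),
         [/\ 0 <= t, measurable B & C = [set p | B (p t)]] ]>>.

Section Processes.
Context {R : realType} (a b : \bar R).
Context {d : measure_display} {T : measurableType d}.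
Variables (F : R -> set (set T)) (P : \bar R -> probability T R).
Variable X : R -> T -> \bar R.

(* [strong_markov_property] says that, for every path event C,
     P_xi(X_(tau + .) \in C | F_tau) = P_(X_tau)(X \in C)
   P_xi-a.s. on {tau < oo}, with the conditional probability expressed by its
   defining integral identity over the events of F_tau.  Deterministic [tau]
   give the simple time-homogeneous Markov property. *)
Record strong_markov : Prop := {
  strong_markov_adapted : adapted F X ;
  strong_markov_start : forall xi, closed_state_space a b xi ->
    P xi [set w | X 0 w = xi] = 1%E ;
  strong_markov_kernel : forall C, path_events C ->
    measurable_fun (closed_state_space a b)
      (fun xi => P xi [set w | C (X^~ w)]) ;
  strong_markov_property : forall xi tau A C,
    closed_state_space a b xi -> stopping_time F tau ->
    stopped_sigma_algebra F tau A -> path_events C ->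
    let A' := A `&` [set w | (tau w < +oo)%E] in
    P xi (A' `&` [set w | C (fun s => X (fine (tau w) + s) w)]) =
    (\int[P xi]_(w in A') P (X (fine (tau w)) w) [set w' | C (X^~ w')])%E }.

(* If zeta = 0 (start at a boundary point) there is no left limit at zeta, and
   the condition reads: X is constant, equal to a point outside E. *)
Record continuous_up_to_death : Prop := {
  continuous_before_death : forall w,
    {within [set t : R | 0 <= t /\ (t%:E < death_time a b X w)%E],
      continuous (X^~ w)} ;
  absorbed_at_death : forall w, (death_time a b X w < +oo)%E ->
    let zeta := fine (death_time a b X w) in
    exists l : \bar R,
      [/\ (closed_state_space a b `\` EFin @` state_space a b) l,
          (0 < zeta -> X t w @[t --> zeta^'-] --> l) &
          (forall s : R, 0 <= s -> X (zeta + s) w = l)] }.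

Definition regular : Prop :=
  forall xi z : R, state_space a b xi -> state_space a b z ->
    (0 < P xi%:E [set w | hitting_time X z%:E w < +oo])%E.

End Processes.

(* Main.v *)
Require Import Defs.
From HB Require Import structures.
From mathcomp Require Import all_boot all_order all_algebra.
From mathcomp Require Import all_classical all_reals all_analysis.
From mathcomp Require Import measurable_realfun.
From mathcomp Require Import ring lra.

(** Let tau_v be the hitting time of v, L u v = E_u[exp(- tau_v)], and
    g u v = exp(- s) where s is the essential infimum of tau_v under P_u. The
    theorem says that g = 1 on E. Regularity gives L > 0, and the strong Markov
    property is only needed at the times tau_v. For v between u and w it yields
    - L u w = L u v * L v w and g u v * g v w <= g u w
      ([hitting_laplace_mul], [hitting_best_mul]);
    - with p the probability, from v, of hitting w before u, and q that of hitting
      u before w, L v w <= p * g v w + q * L u w and L v u <= q + p * L w u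
      ([hitting_laplace_exit]).
    Multiplying the last two inequalities eliminates p and q and shows that the
    ratio r u v = (1 - L u v) / (1 - L v u) satisfies, for u < v < w,
      r v w >= L v w * L v u * r u v + (1 - g v w) / (1 - L w v)
    ([odds_step]). So, along a subdivision of an interval, each step that costs
    time (g < 1) makes the way up harder compared with the way down: since the
    final ratio is finite and the products of the L are bounded below by
    multiplicativity, the sum S of the (1 - g u_i u_(i+1)) / (1 - L u_(i+1) u_i)
    is bounded by a constant C that does not depend on the subdivision. The sum of
    the 1 - L u_(i+1) u_i is bounded by a constant G in the same way. If all the
    t_i = 1 - g u_i u_(i+1) are at most M^-2, the inequality
    2 M t <= t / b + M^2 t b then gives a total of at most (C + G) / (2 M) for the
    t_i, and this total bounds 1 - g from one end to the other because 1 - g is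
    subadditive. As M is arbitrary, g = 1 ([two_point_eq1]).

    Fine subdivisions exist because L v u tends to 1 when v tends to u
    ([hitting_laplace_near]: tau_v increases to tau_u), and because 1 - g v u is
    at most 1 - L v u, and 1 - g u v at most C * (1 - L v u).

    The products of expectations come from the strong Markov property for events
    through uniqueness of product measures ([integral_mul_indep]). That hitting
    times of points are stopping times, and measurable functions of the path,
    comes from continuity: absorption at the death-time makes every path
    continuous, with values in the extended real line, on all of [0, +oo[. *)

Set Implicit Arguments.
Unset Strict Implicit.
Unset Printing Implicit Defensive.

Import Order.TTheory GRing.Theory Num.Theory.
Import numFieldTopology.Exports numFieldNormedType.Exports.

Local Open Scope classical_set_scope.
Local Open Scope ring_scope.

(** * Two-point functions on an interval *)

(** The analytic part of the argument, for functions [L] and [g] of two points of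
    the interval from [x] to [z]. In the application, [L u v] and [g u v] are the
    mean discount exp(- tau_v) and its essential supremum for a motion started at
    [u], and [p], [q] in [L_exit] are the probabilities that the motion, started
    at [v], hits [w] before [u], and [u] before [w]. *)
Section TwoPointFunctions.
Context {R : realType} (L g : R -> R -> R) (x z : R).

(** How much harder it is to go from [u] to [v] than to come back. *)
Definition odds (u v : R) : R := (1 - L u v) / (1 - L v u).

Hypothesis L_gt0 : forall u v, x <= u <= z -> x <= v <= z -> 0 < L u v.
Hypothesis L_le_g : forall u v, x <= u <= z -> x <= v <= z -> L u v <= g u v.
Hypothesis g_le1 : forall u v, x <= u <= z -> x <= v <= z -> g u v <= 1.
Hypothesis L_refl : forall u, x <= u <= z -> L u u = 1.
Hypothesis L_lt1 :
  forall u v, x <= u <= z -> x <= v <= z -> u != v -> L u v < 1.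
Hypothesis L_mul_up : forall u v w, x <= u -> u < v -> v < w -> w <= z ->
  L u w = L u v * L v w.
Hypothesis L_mul_down : forall u v w, x <= u -> u < v -> v < w -> w <= z ->
  L w u = L w v * L v u.
Hypothesis g_mul : forall u v w, x <= u -> u < v -> v < w -> w <= z ->
  g u v * g v w <= g u w.
Hypothesis L_exit : forall u v w, x <= u -> u < v -> v < w -> w <= z ->
  exists p q : R, [/\ 0 <= p, 0 <= q, p + q <= 1,
    L v w <= p * g v w + q * L u w & L v u <= q + p * L w u].
Hypothesis L_left : forall u eta : R, x < u -> u <= z -> 0 < eta ->
  exists2 del : R, 0 < del &
    forall v, x <= v -> u - del < v -> v < u -> 1 - eta < L v u.
Hypothesis L_right : forall u eta : R, x <= u -> u < z -> 0 < eta ->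
  exists2 del : R, 0 < del &
    forall v, v <= z -> v < u + del -> u < v -> 1 - eta < L v u.

Let L_mulW_up u v w : x <= u -> u <= v -> v <= w -> w <= z ->
  L u w = L u v * L v w.
Proof.
move=> xu; rewrite le_eqVlt => /predU1P[uv|uv] vw wz.
  by subst v; rewrite L_refl ?mul1r//; lra.
move: vw wz; rewrite le_eqVlt => /predU1P[vw|vw] wz.
  by subst w; rewrite (L_refl (u := v)) ?mulr1//; lra.
exact: L_mul_up.
Qed.

Let L_mulW_down u v w : x <= u -> u <= v -> v <= w -> w <= z ->
  L w u = L w v * L v u.
Proof.
move=> xu; rewrite le_eqVlt => /predU1P[uv|uv] vw wz.
  by subst v; rewrite (L_refl (u := u)) ?mulr1//; lra.
move: vw wz; rewrite le_eqVlt => /predU1P[vw|vw] wz.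
  by subst w; rewrite L_refl ?mul1r//; lra.
exact: L_mul_down.
Qed.

Let L_le1 u v : x <= u <= z -> x <= v <= z -> L u v <= 1.
Proof. by move=> hu hv; apply: le_trans (L_le_g hu hv) _; exact: g_le1. Qed.

Let odds_ge0 u v : x <= u <= z -> x <= v <= z -> 0 <= odds u v.
Proof. by move=> hu hv; rewrite divr_ge0// subr_ge0 L_le1. Qed.

(** Multiplying the two bounds of [L_exit] makes the weights [p] and [q], about
    which nothing is known, cancel. *)
Lemma odds_step u v w : x <= u -> u < v -> v < w -> w <= z ->
  L v w * L v u * odds u v + (1 - g v w) / (1 - L w v) <= odds v w.
Proof.
move=> xu uv vw wz.
have [p [q [p0 q0 pq H1 H2]]] := L_exit xu uv vw wz.
have hu : x <= u <= z by lra.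
have hv : x <= v <= z by lra.
have hw : x <= w <= z by lra.
have a0 : 0 < 1 - L u v by rewrite subr_gt0 L_lt1// lt_eqF.
have b0 : 0 < 1 - L v u by rewrite subr_gt0 L_lt1// gt_eqF.
have a1 : 0 < 1 - L v w by rewrite subr_gt0 L_lt1// lt_eqF.
have b1 : 0 < 1 - L w v by rewrite subr_gt0 L_lt1// gt_eqF.
rewrite (L_mul_up xu uv vw wz) in H1; rewrite (L_mul_down xu uv vw wz) in H2.
have Lvw := L_gt0 hv hw; have Lvu := L_gt0 hv hu.
have Luv := L_gt0 hu hv; have Lwv := L_gt0 hw hv.
have gL := L_le_g hv hw.
have K1 : q * (L v w * (1 - L u v)) <= p * (g v w - L v w) by nra.
have K2 : p * (L v u * (1 - L w v)) <= q * (1 - L v u) by nra.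
have pgt0 : 0 < p.
  rewrite lt_neqAle p0 andbT; apply/eqP => p00; subst p.
  have q00 : q = 0.
    apply/eqP; rewrite eq_le q0 andbT.
    have : 0 < L v w * (1 - L u v) by rewrite mulr_gt0.
    by move=> ?; nra.
  by subst q; lra.
have qgt0 : 0 < q.
  rewrite lt_neqAle q0 andbT; apply/eqP => q00; subst q.
  have : 0 < L v u * (1 - L w v) by rewrite mulr_gt0.
  by move=> ?; nra.
have K : L v w * (1 - L u v) * (L v u * (1 - L w v)) <=
         (g v w - L v w) * (1 - L v u).
  have : (q * (L v w * (1 - L u v))) * (p * (L v u * (1 - L w v))) <=
         (p * (g v w - L v w)) * (q * (1 - L v u)).
    by apply: ler_pM => //; rewrite !mulr_ge0 ?ltW.
  have -> : (q * (L v w * (1 - L u v))) * (p * (L v u * (1 - L w v))) =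
    (p * q) * (L v w * (1 - L u v) * (L v u * (1 - L w v))) by ring.
  have -> : (p * (g v w - L v w)) * (q * (1 - L v u)) =
    (p * q) * ((g v w - L v w) * (1 - L v u)) by ring.
  by rewrite ler_pM2l// mulr_gt0.
rewrite /odds -lerBrDr -mulrBl.
have -> : 1 - L v w - (1 - g v w) = g v w - L v w by ring.
rewrite ler_pdivlMr//.
have -> : L v w * L v u * ((1 - L u v) / (1 - L v u)) * (1 - L w v) =
    L v w * (1 - L u v) * (L v u * (1 - L w v)) / (1 - L v u) by ring.
by rewrite ler_pdivrMr.
Qed.

(** [subdivision_sums eta y S B T] holds if some subdivision
    x = u_0 < ... < u_n = y with [1 - g u_i u_(i+1) <= eta] for all i has
    S = \sum_i (1 - g u_i u_(i+1)) / (1 - L u_(i+1) u_i),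
    B = \sum_i (1 - L u_(i+1) u_i) and T = \sum_i (1 - g u_i u_(i+1)). *)
Inductive subdivision_sums (eta : R) : R -> R -> R -> R -> Prop :=
| subdivision_nil : subdivision_sums eta x 0 0 0
| subdivision_rcons y w S B T : subdivision_sums eta y S B T ->
    y < w -> w <= z -> 1 - g y w <= eta ->
    subdivision_sums eta w (S + (1 - g y w) / (1 - L w y))
      (B + (1 - L w y)) (T + (1 - g y w)).

Let sub_range eta y S B T : x <= z -> subdivision_sums eta y S B T ->
  x <= y <= z.
Proof. by move=> xz; elim=> [|{}y w {}S {}B {}T _ ? ? ? ?]; lra. Qed.

(** Iterating [odds_step] along the subdivision. *)
Lemma subdivision_odds eta y S B T w :
  subdivision_sums eta y S B T -> y < w -> w <= z -> x < z ->
  L x w * L y x * S + (1 - g y w) / (1 - L w y) <= odds y w.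
Proof.
move=> H yw wz xz; elim: H w yw wz => [w xw wz|].
  have hx : x <= x <= z by lra.
  have hw : x <= w <= z by lra.
  rewrite mulr0 add0r /odds ler_pM2r ?lerB ?L_le_g//.
  by rewrite invr_gt0 subr_gt0 L_lt1// gt_eqF.
move=> {}y w {}S {}B {}T Hy IH yw wz _ v wv vz.
have := sub_range (ltW xz) Hy => /andP[xy yz].
have {}IH := IH _ yw wz.
have hv : x <= v <= z by lra.
have hy : x <= y <= z by lra.
have hw : x <= w <= z by lra.
have hx : x <= x <= z by lra.
apply: le_trans (odds_step xy yw wv vz).
rewrite lerD2r.
have cpos : 0 < L w v * L w y by rewrite mulr_gt0// L_gt0.
apply: (@le_trans _ _
  (L w v * L w y * (L x w * L y x * S + (1 - g y w) / (1 - L w y)))); last first.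
  by rewrite ler_pM2l.
rewrite !mulrDr lerD//.
  have -> : L x v = L x w * L w v by apply: L_mulW_up; lra.
  have -> : L w x = L w y * L y x by apply: L_mulW_down; lra.
  by rewrite le_eqVlt; apply/orP; left; apply/eqP; ring.
apply: ler_wpM2r.
  rewrite divr_ge0 ?subr_ge0 ?g_le1//.
  by rewrite L_le1.
have -> : L x v = L x w * L w v by apply: L_mulW_up; lra.
have -> : L w x = L w y * L y x by apply: L_mulW_down; lra.
rewrite (_ : _ * _ = (L x w * L y x) * (L w v * L w y)); last by ring.
apply: ler_piMl; first exact: ltW.
by apply: mulr_ile1; rewrite ?L_le1// ltW// L_gt0.
Qed.

Lemma subdivision_down eta y S B T : x < z -> subdivision_sums eta y S B T ->
  B <= (L y x)^-1 - 1.
Proof.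
move=> xz; elim=> [|{}y w {}S {}B {}T Hy IH yw wz _].
  by rewrite L_refl ?invr1 ?subrr//; lra.
have /andP[xy yz] := sub_range (ltW xz) Hy.
have hw : x <= w <= z by lra.
have hy : x <= y <= z by lra.
have hx : x <= x <= z by lra.
have -> : L w x = L w y * L y x by apply: L_mulW_down; lra.
have Lyx := L_gt0 hy hx; have Lwy := L_gt0 hw hy.
have Lyx1 := L_le1 hy hx; have Lwy1 := L_le1 hw hy.
rewrite invfM.
have i1 : 1 <= (L y x)^-1 by rewrite invf_ge1.
have i2 : 1 <= (L w y)^-1 by rewrite invf_ge1.
have aL : (L w y)^-1 * L w y = 1 by rewrite mulVf// gt_eqF.
have h1 : 0 <= (1 - L w y) * ((L w y)^-1 - 1) by rewrite mulr_ge0 ?subr_ge0.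
have h2 : 0 <= ((L w y)^-1 - 1) * ((L y x)^-1 - 1) by rewrite mulr_ge0 ?subr_ge0.
move: aL h1 h2 IH; set a := (L w y)^-1; set b := (L y x)^-1 => *.
lra.
Qed.

Lemma subdivision_g eta y S B T : x < z -> subdivision_sums eta y S B T ->
  1 - g x y <= T.
Proof.
move=> xz; elim=> [|{}y w {}S {}B {}T Hy IH yw wz _].
  have hx : x <= x <= z by lra.
  by rewrite subr_le0; apply: le_trans (L_le_g hx hx); rewrite L_refl.
have /andP[xy yz] := sub_range (ltW xz) Hy.
have hw : x <= w <= z by lra.
have hy : x <= y <= z by lra.
have hx : x <= x <= z by lra.
have G1 := g_le1 hy hw; have G2 := g_le1 hx hy.
move: xy; rewrite le_eqVlt => /predU1P[xy|xy].
  by subst y; lra.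
have := g_mul (lexx x) xy yw wz.
by move=> ?; nra.
Qed.

(** The mean inequality 2 M t <= t / b + M^2 t b, summed over the subdivision. *)
Lemma subdivision_mean eta y S B T (M : R) : x < z -> 0 <= M ->
  subdivision_sums eta y S B T -> 2 * M * T <= S + M ^+ 2 * eta * B.
Proof.
move=> xz M0; elim=> [|{}y w {}S {}B {}T Hy IH yw wz te]; first by nra.
have /andP[xy yz] := sub_range (ltW xz) Hy.
have hw : x <= w <= z by lra.
have hy : x <= y <= z by lra.
have b0 : 0 < 1 - L w y by rewrite subr_gt0 L_lt1// gt_eqF.
have t0 : 0 <= 1 - g y w by rewrite subr_ge0 g_le1.
move: te b0 t0; move: (1 - g y w) (1 - L w y) => t b te b0 t0.
rewrite !mulrDr addrACA lerD//.
apply: (@le_trans _ _ (t / b + M ^+ 2 * t * b)).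
  have -> : t / b + M ^+ 2 * t * b = t / b * (1 + (M * b) ^+ 2).
    by field; rewrite gt_eqF.
  have -> : 2 * M * t = t / b * (2 * (M * b)).
    by field; rewrite gt_eqF.
  apply: ler_wpM2l; first by rewrite divr_ge0// ltW.
  by have := sqr_ge0 (M * b - 1); lra.
by rewrite lerD2l ler_wpM2r ?(ltW b0)// ler_wpM2l// sqr_ge0.
Qed.

Lemma subdivision_bound eta y S B T : subdivision_sums eta y S B T ->
  x <= y -> y < z -> S <= odds y z / (L x z * L y x).
Proof.
move=> H xy yz; have xz : x < z by lra.
have hz : x <= z <= z by lra.
have hy : x <= y <= z by lra.
have hx : x <= x <= z by lra.
rewrite ler_pdivlMr; last by rewrite mulr_gt0// L_gt0.
rewrite mulrC; apply: le_trans (subdivision_odds H yz (lexx _) xz).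
rewrite lerDl divr_ge0// subr_ge0; [exact: g_le1|exact: L_le1].
Qed.

(** Subdivisions that are arbitrarily fine for [g] exist, although nothing is
    assumed on [L u v] or [g u v] as [v] tends to [u]: on the left of a point [u],
    1 - g v u <= 1 - L v u is small, and on its right [subdivision_bound]
    controls 1 - g u v by the small quantity 1 - L v u. *)
Lemma subdivision_exists eta y : 0 < eta -> x <= y -> y < z ->
  exists S B T, subdivision_sums eta y S B T.
Proof.
move=> eta0 xy yz; have xz : x < z by lra.
have hz : x <= z <= z by lra.
have hx : x <= x <= z by lra.
have hy : x <= y <= z by lra.
pose C := odds y z / (L x z * L y x).
have bzy : 0 < 1 - L z y by rewrite subr_gt0 L_lt1// gt_eqF.
have C0 : 0 <= C.
  by rewrite divr_ge0 ?odds_ge0// mulr_ge0// ltW// L_gt0.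
(* refine the interval from u to v to a subdivision from x to y; the mesh 1 is
   no constraint *)
have tC u v : x <= u -> u < v -> v <= y -> 1 - g u v <= C * (1 - L v u).
  move=> xu uv vy.
  have hu : x <= u <= z by lra.
  have hv : x <= v <= z by lra.
  have bvu : 0 < 1 - L v u by rewrite subr_gt0 L_lt1// gt_eqF.
  have g1 p q : x <= p <= z -> x <= q <= z -> 1 - g p q <= 1.
    move=> hp hq; rewrite gerBl; apply: le_trans (L_le_g hp hq).
    by rewrite ltW// L_gt0.
  have sub_le p q S B T : subdivision_sums 1 p S B T -> x <= p -> p <= q ->
      q <= y -> exists S' B' T', subdivision_sums 1 q S' B' T' /\ S <= S'.
    move=> Hp xp; rewrite le_eqVlt => /predU1P[<-|pq] qy.
      by exists S, B, T.
    do 3 eexists; split.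
      by apply: (subdivision_rcons Hp) => //; [lra|apply: g1; lra].
    rewrite lerDl divr_ge0// subr_ge0; [apply: g_le1; lra|apply: L_le1; lra].
  have uy : u <= y by lra.
  have [S1 [B1 [T1 [H1 S1u]]]] :=
    sub_le _ u _ _ _ (subdivision_nil 1) (lexx _) xu uy.
  have H2 := subdivision_rcons H1 uv ltac:(lra) (g1 _ _ hu hv).
  have [S3 [B3 [T3 [H3 S3u]]]] := sub_le _ y _ _ _ H2 ltac:(lra) vy (lexx _).
  have := subdivision_bound H3 xy yz; rewrite -/C => S3C.
  rewrite -ler_pdivrMr//; lra.
(* the set of points reached by fine subdivisions contains its supremum, which is y *)
pose A := [set u : R | x <= u <= y /\ exists S B T, subdivision_sums eta u S B T].
have Ax : A x by split; [lra|exists 0, 0, 0; exact: subdivision_nil].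
have supA : has_sup A by split; [exists x|exists y => u [/andP[]]].
have : exists s, (forall u, A u -> u <= s) /\
    (forall e : R, 0 < e -> exists2 u, A u & s - e < u).
  exists (sup A); split; first by move=> u Au; apply: ub_le_sup => //; exact: supA.2.
  by move=> e e0; exact: sup_adherent.
move=> [s [s_ub s_adh]].
have xs : x <= s by exact: s_ub.
have sy : s <= y.
  rewrite leNgt; apply/negP => ys.
  have [u [/andP[_ uy] _]] := s_adh _ (ltac:(by rewrite subr_gt0) : 0 < s - y).
  by rewrite subKr ltNge uy.
have As : A s.
  move: xs; rewrite le_eqVlt => /predU1P[<- //|xs].
  have sz : s <= z by lra.
  have [del del0 Hdel] := L_left xs sz eta0.
  have [u Au su] := s_adh _ del0.
  have us : u <= s by exact: s_ub.
  move: us; rewrite le_eqVlt => /predU1P[<- //|us].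
  move: Au => [/andP[xu uy] [S [B [T H]]]].
  split; first by lra.
  do 3 eexists; apply: (subdivision_rcons H us); first by lra.
  have := Hdel u xu su us.
  have : L u s <= g u s by apply: L_le_g; lra.
  by move=> ? ?; lra.
suff -> : y = s by case: As.
apply/eqP; rewrite eq_le sy andbT leNgt; apply/negP => {}sy.
have C10 : 0 < C + 1 by lra.
have [del del0 Hdel] := L_right xs (lt_trans sy yz) (divr_gt0 eta0 C10).
have [v [sv vy vd]] : exists v, [/\ s < v, v <= y & v < s + del].
  exists (Num.min y (s + del / 2)); split.
  - by rewrite lt_min sy/=; lra.
  - by rewrite ge_min lexx.
  - by apply: (@le_lt_trans _ _ (s + del / 2)); [rewrite ge_min lexx orbT|lra].
have vz : v <= z by lra.
have Hv := Hdel v vz vd sv.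
have : v <= s.
  apply: s_ub; split; first by lra.
  case: As => _ [S [B [T H]]].
  do 3 eexists; apply: (subdivision_rcons H sv); first by lra.
  apply: le_trans (tC _ _ _ sv vy) _ => //.
  apply: (@le_trans _ _ (C * (eta / (C + 1)))); first by rewrite ler_wpM2l//; lra.
  by rewrite mulrA ler_pdivrMr//; nra.
by lra.
Qed.

(** For subdivisions of mesh [M ^- 2] the total T is at most (C + G) / (2 M),
    where C and G do not depend on [M], whereas 1 - g x y <= T. *)
Theorem two_point_eq1 y : x <= y -> y < z -> g x y = 1.
Proof.
move=> xy yz; have xz : x < z by lra.
have hz : x <= z <= z by lra.
have hx : x <= x <= z by lra.
have hy : x <= y <= z by lra.
apply/eqP; rewrite eq_le g_le1//= leNgt; apply/negP => gxy.
pose C := odds y z / (L x z * L y x).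
pose G := (L y x)^-1 - 1.
have bzy : 0 < 1 - L z y by rewrite subr_gt0 L_lt1// gt_eqF.
have C0 : 0 <= C.
  by rewrite divr_ge0 ?odds_ge0// mulr_ge0// ltW// L_gt0.
have G0 : 0 <= G by rewrite subr_ge0 invf_ge1 ?L_gt0 ?L_le1.
pose M := (C + G + 1) / (1 - g x y).
have M0 : 0 < M by rewrite divr_gt0; lra.
have M20 : 0 < M ^- 2 by rewrite invr_gt0 exprn_gt0.
have [S [B [T H]]] := subdivision_exists M20 xy yz.
have h1 := subdivision_bound H xy yz.
have h2 := subdivision_down xz H.
have h3 := subdivision_g xz H.
have h4 := subdivision_mean xz (ltW M0) H.
rewrite divff ?mul1r in h4; last by rewrite gt_eqF// exprn_gt0.
rewrite -/C in h1; rewrite -/G in h2.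
have MT : M * (1 - g x y) <= M * T by rewrite ler_pM2l.
have : M * (1 - g x y) = C + G + 1 by rewrite /M divfK// gt_eqF//; lra.
by move=> ?; lra.
Qed.

End TwoPointFunctions.

(** * Hitting times of continuous paths *)

Section Paths.
Context {R : realType}.
Implicit Types (p : R -> \bar R) (s t : R) (z : \bar R).

(** Continuity of [p] on the times t >= 0, in the topology of the extended real
    line: [contract] is a homeomorphism onto [-1, 1], and [`|t|] turns a path on
    the half-line into a function on the whole line. *)
Definition cpath p := continuous (fun t => contract (p `|t|)).

(** The hitting time as a functional of the path, that is, the hitting time of
    the coordinate process. *)
Definition first_hit z p : \bar R :=
  hitting_time (fun t (q : R -> \bar R) => q t) z p.

Definition shift (s : R) p : R -> \bar R := fun r => p (s + r).

Let cdist p z := fun t : R => `|contract (p `|t|) - contract z|.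

Let cdist_continuous p z : cpath p -> continuous (cdist p z).
Proof.
move=> cp t; apply: cvg_norm.
by apply: cvgB; [exact: cp|exact: cvg_cst].
Qed.

Let cdist_eq0 p z t : 0 <= t -> cdist p z t = 0 -> p t = z.
Proof.
move=> t0 /normr0_eq0/subr0_eq/contract_inj.
by rewrite ger0_norm.
Qed.

Lemma first_hit_ge0 z p : (0 <= first_hit z p)%E.
Proof. by apply/ereal_infP => _ [t [t0 _] <-]; rewrite lee_fin. Qed.

Lemma first_hit_le z p t : 0 <= t -> p t = z -> (first_hit z p <= t%:E)%E.
Proof. by move=> t0 pt; apply: ereal_inf_lbound; exists t. Qed.

Lemma cpath_away p z t : cpath p -> 0 <= t -> (forall s, 0 <= s <= t -> p s <> z) ->
  exists2 e, 0 < e & forall s, 0 <= s <= t -> e <= `|contract (p s) - contract z|.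
Proof.
move=> cp t0 pz.
have [|c] := @EVT_min R (cdist p z) 0 t t0.
  exact/continuous_subspaceT/cdist_continuous.
rewrite in_itv/= => c0t cmin; exists (cdist p z c).
  rewrite lt_neqAle normr_ge0 andbT eq_sym; apply/eqP => c0.
  by apply: (pz _ c0t); apply: cdist_eq0 c0; case/andP: c0t.
move=> s s0t; have := cmin s; rewrite in_itv/= s0t => /(_ isT) /le_trans; apply.
by rewrite /cdist [ `|s| ]ger0_norm//; case/andP: s0t.
Qed.

Lemma first_hit_leP p z t : cpath p -> 0 <= t ->
  (first_hit z p <= t%:E)%E <-> exists2 s, 0 <= s <= t & p s = z.
Proof.
move=> cp t0; split; last first.
  move=> [s /andP[s0 st] psz]; apply: le_trans (first_hit_le s0 psz) _.
  by rewrite lee_fin.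
move=> ht; apply: contrapT => nex.
have pz s : 0 <= s <= t -> p s <> z by move=> hs ps; apply: nex; exists s.
have t0t : 0 <= t <= t by rewrite t0 lexx.
have ft : 0 < cdist p z t.
  rewrite lt_neqAle normr_ge0 andbT eq_sym; apply/eqP => /(cdist_eq0 t0).
  exact: pz.
have /nbhs_ballP[del /= del0 Hdel] : \forall r \near t, 0 < cdist p z r.
  by apply: cvgr_gt (@cdist_continuous p z cp t) _ ft.
have : ((t + del)%:E <= first_hit z p)%E.
  apply/ereal_infP => _ [s [s0 ps] <-]; rewrite lee_fin leNgt; apply/negP => std.
  have [st|ts] := leP s t; first by apply: (pz s) => //; rewrite s0.
  have : 0 < cdist p z s.
    by apply: Hdel; rewrite /ball/= ler0_norm; lra.
  by rewrite /cdist (ger0_norm s0) ps subrr normr0 ltxx.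
move=> /le_trans/(_ ht); rewrite lee_fin; lra.
Qed.

Lemma first_hit_attained p z : cpath p -> (first_hit z p < +oo)%E ->
  p (fine (first_hit z p)) = z.
Proof.
move=> cp h; have h0 := first_hit_ge0 z p.
have hfin : first_hit z p \is a fin_num by rewrite ge0_fin_numE.
have [|s /andP[s0 st] ps] :=
    (@first_hit_leP p z (fine (first_hit z p)) cp (fine_ge0 h0)).1.
  by rewrite fineK.
suff -> : fine (first_hit z p) = s by [].
by apply/eqP; rewrite eq_le st andbT -lee_fin fineK// first_hit_le.
Qed.

(** The event that [z] is hit by time [t], in terms of countably many times: as q
    ranges over the rationals, [Num.min t `|ratr q|] ranges over a dense subset
    of the interval [0, t]. *)
Lemma first_hit_approxP p z t : cpath p -> 0 <= t ->
  (first_hit z p <= t%:E)%E <-> forall n : nat, exists q : rat,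
    `|contract (p (Num.min t `|ratr q|)) - contract z| < n.+1%:R^-1.
Proof.
move=> cp t0; split.
  move=> /(first_hit_leP _ cp t0)[s /andP[s0 st] ps] n.
  have n0 : 0 < n.+1%:R^-1 :> R by rewrite invr_gt0.
  have fs : cdist p z s < n.+1%:R^-1.
    by rewrite /cdist (ger0_norm s0) ps subrr normr0.
  have /nbhs_ballP[del /= del0 Hdel] :
      \forall r \near s, cdist p z r < n.+1%:R^-1.
    by apply: cvgr_lt (@cdist_continuous p z cp s) _ fs.
  have [q] : exists q : rat, ratr q \in `]s - del, s + del[ by apply: rat_in_itvoo; lra.
  rewrite in_itv/= => /andP[q1 q2]; exists q.
  have : cdist p z (Num.min t `|ratr q|) < n.+1%:R^-1.
    have r1 : s - del < Num.min t `|ratr q|.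
      rewrite lt_min; apply/andP; split; first lra.
      by apply: lt_le_trans (ler_norm _).
    have r2 : Num.min t `|ratr q| < s + del.
      apply: (@le_lt_trans _ _ `|ratr q|); first by rewrite ge_min lexx orbT.
      by rewrite ltr_norml; lra.
    by apply: Hdel; rewrite /ball/= ltr_norml; lra.
  by rewrite /cdist [ `|Num.min _ _| ]ger0_norm// le_min t0/= normr_ge0.
move=> H; apply/(first_hit_leP _ cp t0); apply: contrapT => nex.
have [|e e0 He] := @cpath_away p z t cp t0.
  by move=> s hs ps; apply: nex; exists s.
have [n ne] : exists n : nat, n.+1%:R^-1 < e.
  have [n _ Hn] := near_infty_natSinv_lt (PosNum e0).
  by exists n; apply: Hn => /=.
have [q Hq] := H n.
have := He (Num.min t `|ratr q|).
rewrite le_min t0/= normr_ge0/= ge_min lexx => /(_ isT).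
by rewrite leNgt (lt_trans Hq ne).
Qed.

Lemma cpath_shift p s : 0 <= s -> cpath p -> cpath (shift s p).
Proof.
move=> s0 cp t.
have -> : (fun t : R => contract (shift s p `|t|)) =
    (fun t => contract (p `|t|)) \o (fun t => s + `|t|).
  by apply/funext => r /=; rewrite /shift (@ger0_norm _ (s + `|r|))// addr_ge0.
apply: continuous_comp; last exact: cp.
by apply: cvgD; [exact: cvg_cst|exact: norm_continuous].
Qed.

Lemma first_hit_shift_le p z s : 0 <= s ->
  (first_hit z p <= s%:E + first_hit z (shift s p))%E.
Proof.
move=> s0; rewrite -leeBlDl//; apply/ereal_infP => _ [t [t0 pt] <-].
by rewrite leeBlDl// -EFinD; apply: first_hit_le; rewrite ?addr_ge0.
Qed.

Lemma first_hit_shift p z s : 0 <= s -> (s%:E <= first_hit z p)%E ->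
  first_hit z p = (s%:E + first_hit z (shift s p))%E.
Proof.
move=> s0 sh; apply/eqP; rewrite eq_le first_hit_shift_le//=.
apply/ereal_infP => _ [t [t0 pt] <-].
have st : s <= t by rewrite -lee_fin; apply: le_trans sh (first_hit_le t0 pt).
rewrite -leeBrDl// -EFinB; apply: first_hit_le; first by rewrite subr_ge0.
by rewrite /shift subrKC.
Qed.

Lemma first_hit_between p (u v w : R) : cpath p -> p 0 = u%:E ->
  (u <= v <= w) || (w <= v <= u) -> (first_hit v%:E p <= first_hit w%:E p)%E.
Proof.
move=> cp p0 uvw; have h0 := first_hit_ge0 w%:E p.
have [->|hw] := eqVneq (first_hit w%:E p) +oo%E; first by rewrite leey.
have {}hw : (first_hit w%:E p < +oo)%E by rewrite lt_neqAle hw leey.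
have pw := first_hit_attained cp hw.
have t0 := fine_ge0 h0.
have <- : (fine (first_hit w%:E p))%:E = first_hit w%:E p.
  by rewrite fineK// ge0_fin_numE.
move: (fine _) pw t0 => t pw t0.
have [||c cI pc] := @IVT R (fun t => contract (p `|t|)) 0 t (contract v%:E) t0.
- exact: continuous_subspaceT.
- rewrite normr0 p0 (ger0_norm t0) pw.
  by rewrite ge_min le_max !le_contract !lee_fin; lra.
have {}pc := contract_inj pc.
move: cI; rewrite in_itv/= => /andP[c0 ct]; rewrite ger0_norm// in pc.
by apply: le_trans (first_hit_le c0 pc) _; rewrite lee_fin.
Qed.

Lemma first_hit_gt0 p z : cpath p -> p 0 <> z -> (0 < first_hit z p)%E.
Proof.
move=> cp p0; rewrite lt_neqAle first_hit_ge0 andbT; apply/eqP => h0.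
by apply: p0; have := @first_hit_attained p z cp; rewrite -h0/=; apply; exact: ltry.
Qed.

(** Lower semicontinuity of the hitting time in the target. *)
Lemma first_hit_near p (u : R) (t : R) : cpath p -> 
  (t%:E < first_hit u%:E p)%E ->
  \forall v \near u, (t%:E < first_hit v%:E p)%E.
Proof.
move=> cp tu; have [t0|t0] := ltP t 0.
  by near=> v; apply: lt_le_trans (first_hit_ge0 _ _); rewrite lte_fin.
have [|e e0 He] := @cpath_away p u%:E t cp t0.
  move=> s /andP[s0 st] ps; move: tu; rewrite ltNge => /negP; apply.
  by apply: le_trans (first_hit_le s0 ps) _; rewrite lee_fin.
have cc : {for u, continuous (fun v : R => contract v%:E)}.
  have /cvg_ballP H : (v%:E @[v --> u] --> u%:E)%E by exact: cvg_id.
  apply/cvg_ballP => r r0; exact: H r r0.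
have cu : `|contract u%:E - contract u%:E| < e by rewrite subrr normr0.
have : \forall v \near u, `|contract u%:E - contract v%:E| < e.
  by have /cvgr_dist_lt := cc; exact.
apply: filterS => v; rewrite distrC => Hv.
rewrite ltNge; apply/negP => /(first_hit_leP _ cp t0)[s s0t ps].
by have := He s s0t; rewrite ps leNgt Hv.
Unshelve. all: by end_near. Qed.

End Paths.

(** * Continuity of the paths of the process *)

Section PathContinuity.
Context {R : realType} (a b : \bar R) {d : measure_display} {T : measurableType d}.

Lemma death_time_ge0 (X : R -> T -> \bar R) w : (0 <= death_time a b X w)%E.
Proof. by apply/ereal_infP => _ [t [t0 _] <-]; rewrite lee_fin. Qed.

(** Since the left limit at the death-time is the value in which the path is
    absorbed, the whole path is continuous, in the extended real line. *)
Lemma continuous_up_to_death_cpath (X : R -> T -> \bar R) :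
  continuous_up_to_death a b X -> forall w, cpath (X^~ w).
Proof.
move=> [cX aX] w t; pose p := X^~ w; rewrite -/p.
have z0 := death_time_ge0 X w.
have norm_near (Q : set R) :
    (\forall r \near `|t|, 0 <= r -> Q r) -> \forall s \near t, Q `|s|.
  move=> HQ; have : \forall s \near t, 0 <= `|s| -> Q `|s|.
    exact: (@norm_continuous _ R t [set r | 0 <= r -> Q r]).
  by apply: filterS => s; apply; exact: normr_ge0.
apply/cvgrPdist_lt => e e0 /=.
apply: (norm_near (fun r => `|contract (p `|t|) - contract (p r)| < e)).
have [tz|zt] := ltP (`|t|%:E) (death_time a b X w).
  have /subspace_continuousP/(_ `|t|) := cX w.
  move=> /(_ (conj (normr_ge0 t) tz)) /cvg_ballP/(_ _ e0).
  rewrite near_withinE => H.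
  have [z zz tz'] : exists2 z : R, (z%:E <= death_time a b X w)%E & `|t| < z.
    case: (death_time a b X w) tz => [r|_|//].
      by rewrite lte_fin => tr; exists r.
    by exists (`|t| + 1); [rewrite leey|rewrite ltrDl].
  have Hz : \forall r \near `|t|, r < z by exact: lt_nbhsl.
  move: H Hz; apply: filterS2 => r Hr rz r0; apply: Hr; split => //.
  by apply: lt_le_trans zz; rewrite lte_fin.
have zoo : (death_time a b X w < +oo)%E by rewrite (le_lt_trans zt)// ltry.
have [l [_ left_l right_l]] := aX w zoo.
have zfin : death_time a b X w \is a fin_num by rewrite ge0_fin_numE.
move: z0 zt left_l right_l; rewrite -{1 2}(fineK zfin) !lee_fin.
move: (fine _) => z z0 zt left_l right_l.
have pl r : z <= r -> p r = l.
  by move=> zr; rewrite /p -(right_l (r - z)) ?subr_ge0// subrKC.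
rewrite (pl _ zt).
have [zt'|tz] := ltP z `|t|.
  near=> r => _; rewrite pl ?subrr ?normr0//.
  by apply/ltW; near: r; exact: lt_nbhsr.
have -> : `|t| = z by apply/eqP; rewrite eq_le tz zt.
have [z00|zp] := leP z 0.
  by near=> r => r0; rewrite pl ?subrr ?normr0// (le_trans z00).
have /cvg_ballP/(_ _ e0) := left_l zp.
rewrite near_withinE => H.
move: H; apply: filterS => r Hr r0.
have [rz|zr] := ltP r z; first exact: Hr.
by rewrite pl// subrr normr0.
Unshelve. all: by end_near.
Qed.

End PathContinuity.

(** * Measurability of hitting times *)

Section SigmaAlgebras.
Context {T : Type} (K : set (set T)) (sK : sigma_algebra setT K).

Lemma sigma_algebra_setC A : K A -> K (~` A).
Proof. by case: sK => _ KC _ /KC; rewrite setTD. Qed.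

Lemma sigma_algebra_setT : K setT.
Proof. by rewrite -setC0; apply: sigma_algebra_setC; case: sK. Qed.

Lemma sigma_algebra_bigcup_rat (A : rat -> set T) :
  (forall q, K (A q)) -> K (\bigcup_q A q).
Proof.
move=> KA; case: (sK) => K0 _ KU.
rewrite (_ : \bigcup_q A q = \bigcup_n
    (if unpickle n is Some q then A q else set0)).
  by apply: KU => n; case: unpickle => [q|]; [exact: KA|exact: K0].
apply/seteqP; split=> [w [q _ Aq]|w [n _]].
  by exists (pickle q); first exact: I; rewrite pickleK.
by case: (unpickle n) => // q Aq; exists q.
Qed.

Lemma sigma_algebra_bigcap (A : nat -> set T) :
  (forall n, K (A n)) -> K (\bigcap_n A n).
Proof.
move=> KA; rewrite -[X in K X]setCK setC_bigcap; apply: sigma_algebra_setC.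
by case: (sK) => _ _; apply => n; apply: sigma_algebra_setC.
Qed.

Lemma sigma_algebra_setI A B : K A -> K B -> K (A `&` B).
Proof.
move=> KA KB; rewrite (_ : A `&` B = \bigcap_n (if n is 0%N then A else B)).
  by apply: sigma_algebra_bigcap; case.
apply/seteqP; split=> [w [Aw Bw] [|n] _ //|w AB].
by split; [exact: (AB 0%N)|exact: (AB 1%N)].
Qed.

Lemma sigma_algebra_setD A B : K A -> K B -> K (A `\` B).
Proof. by move=> KA /sigma_algebra_setC; rewrite setDE; exact: sigma_algebra_setI. Qed.

End SigmaAlgebras.

(** The sigma-algebra of the extended real line is generated by open rays. *)
Lemma emeasurable_sub {R : realType} (K : set (set (\bar R))) :
  sigma_algebra setT K -> (forall r : R, K [set x | (r%:E < x)%E]) ->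
  measurable `<=` K.
Proof.
move=> sK KG.
rewrite (_ : measurable = emeasurable (@ocitv R))//.
rewrite ErealGenOInfty.measurableE; apply: smallest_sub => // _ [r ->].
rewrite (_ : `]r%:E, +oo[%classic = [set x | (r%:E < x)%E]) //.
by apply/seteqP; split=> x /=; rewrite in_itv/= andbT.
Qed.

Lemma measurable_contract {R : realType} : measurable_fun setT (@contract R).
Proof.
move=> _; apply: (measurability _ (RGenCInfty.measurableE R)) => //.
move=> _ [_ [r ->] <-]; rewrite setTI.
have [r1|r1] := leP r (-1).
  rewrite (_ : _ @^-1` _ = setT)//; apply/seteqP; split=> x //= _.
  rewrite in_itv/= andbT; apply: le_trans r1 _.
  by have := contract_le1 x; rewrite ler_norml => /andP[].
have [r2|r2] := ltP 1 r.
  rewrite (_ : _ @^-1` _ = set0)//; apply/seteqP; split=> x //=.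
  rewrite in_itv/= andbT => rx; have := contract_le1 x.
  by rewrite ler_norml => /andP[_]; lra.
rewrite (_ : _ @^-1` _ = `[expand r, +oo[%classic).
  exact: emeasurable_itv.
have r3 : r \in [pred r : R | `|r| <= 1] by rewrite inE ler_norml; lra.
apply/seteqP; split=> x /=; rewrite !in_itv/= !andbT;
  by rewrite -[(expand r <= x)%E]le_contract expandK.
Qed.

Section HittingEvents.
Context {R : realType}.

Lemma sigma_algebra_approx_hit {T : Type} (K : set (set T)) (Y : R -> T -> \bar R)
    (t : R) (z : \bar R) : sigma_algebra setT K -> 0 <= t ->
  (forall (s : R) B, 0 <= s <= t -> measurable B -> K (Y s @^-1` B)) ->
  K [set w | forall n : nat, exists q : rat,
    `|contract (Y (Num.min t `|ratr q|) w) - contract z| < n.+1%:R^-1].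
Proof.
move=> sK t0 KY.
rewrite (_ : mkset _ = \bigcap_n \bigcup_q (Y (Num.min t `|ratr q|) @^-1`
    (@contract R @^-1` (ball (contract z) (n.+1%:R^-1 : R))))).
  apply: (sigma_algebra_bigcap sK) => n; apply: (sigma_algebra_bigcup_rat sK) => q.
  apply: KY; first by rewrite le_min t0/= normr_ge0/= ge_min lexx.
  rewrite -[X in measurable X]setTI; apply: measurable_contract => //.
  exact: measurable_ball.
apply/seteqP; split=> w /= H n.
  by move=> _; have [q Hq] := H n; exists q => //=; rewrite /ball/= distrC.
by have [q _] := H n I; rewrite /ball/= distrC; exists q.
Qed.

(** On continuous paths, the hitting time is measurable for the product
    sigma-algebra. *)
Lemma first_hit_path_event (z : \bar R) (B : set (\bar R)) : measurable B ->
  exists2 C, path_events C & forall p, cpath p -> C p <-> B (first_hit z p).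
Proof.
have sP : sigma_algebra setT (@path_events R) by exact: smallest_sigma_algebra.
move: B; apply: emeasurable_sub.
  split.
  - by exists set0 => //; case: sP.
  - move=> A [C KC CA]; exists (~` C); first exact: (sigma_algebra_setC sP).
    by move=> p cp; rewrite setTD /= -(CA p cp).
  - move=> A KA.
    have /choice[C HC] : forall n, exists C, path_events C /\
        forall p, cpath p -> C p <-> A n (first_hit z p).
      by move=> n; have [C ? ?] := KA n; exists C.
    exists (\bigcup_n C n).
      by case: sP => _ _; apply => n; case: (HC n).
    move=> p cp; split=> [[n _ Cn]|[n _ An]]; exists n => //;
      by apply/(HC n).2.
move=> r; have [r0|r0] := ltP r 0.
  exists setT; first exact: (sigma_algebra_setT sP).
  by move=> p _; split=> // _ /=; apply: lt_le_trans (first_hit_ge0 _ _); rewrite lte_fin.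
have K1 := @sigma_algebra_approx_hit _ _ (fun t (q : R -> \bar R) => q t) r z sP r0.
exists (~` [set p : R -> \bar R | forall n : nat, exists q : rat,
    `|contract (p (Num.min r `|ratr q|)) - contract z| < n.+1%:R^-1]).
  apply: (sigma_algebra_setC sP); apply: K1 => s A /andP[s0 _] mA.
  by apply: sub_sigma_algebra; exists s, A.
move=> p cp /=; rewrite ltNge; split.
  by move=> h; apply/negP => /(first_hit_approxP _ cp r0).
by move=> /negP h1 /(first_hit_approxP _ cp r0).
Qed.

Context {d : measure_display} {T : measurableType d}.
Variables (F : R -> set (set T)) (hF : filtration F).

Lemma stopping_time_measurable (tau : T -> \bar R) :
  stopping_time F tau -> measurable_fun setT tau.
Proof.
move=> [tau0 Ftau] _ B; rewrite setTI; move: B.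
apply: (@emeasurable_sub _ [set B | measurable (tau @^-1` B)]).
  split=> [|A mA|A mA] /=.
  - by rewrite preimage_set0.
  - by rewrite setTD preimage_setC; exact: measurableC.
  - by rewrite preimage_bigcup; exact: bigcupT_measurable.
move=> r /=; rewrite (_ : _ @^-1` _ = ~` [set w | (tau w <= r%:E)%E]); last first.
  by apply/seteqP; split=> w /=; rewrite ltNge => /negP.
apply: measurableC; have [r0|r0] := ltP r 0; last first.
  by apply: (filtration_sub hF r0); exact: Ftau.
rewrite (_ : mkset _ = set0)//; apply/seteqP; split=> w //= /(le_trans (tau0 w)).
by rewrite lee_fin leNgt r0.
Qed.

Lemma stopped_sigma_algebraP (tau : T -> \bar R) : stopping_time F tau ->
  sigma_algebra setT (stopped_sigma_algebra F tau).
Proof.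
move=> [_ Ftau]; have sF := filtration_sigma_algebra hF; split.
- split=> // t t0; rewrite set0I; by case: (sF t t0).
- move=> A [mA FA]; split; first by rewrite setTD; exact: measurableC.
  move=> t t0; rewrite (_ : _ `&` _ = [set w | (tau w <= t%:E)%E] `\`
      (A `&` [set w | (tau w <= t%:E)%E])).
    exact: (sigma_algebra_setD (sF _ t0) (Ftau _ t0) (FA _ t0)).
  by apply/seteqP; split=> w /= => [[[_ nA] tw]|[tw nA]]; split=> //;
    [case|split=> // Aw; exact: nA].
- move=> A FA; split; first by apply: bigcupT_measurable => n; case: (FA n).
  move=> t t0; rewrite setI_bigcupl; case: (sF t t0) => _ _; apply => n.
  by case: (FA n) => _; apply.
Qed.

Lemma stopped_preimage (tau : T -> \bar R) (B : set (\bar R)) :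
  stopping_time F tau -> measurable B -> stopped_sigma_algebra F tau (tau @^-1` B).
Proof.
move=> st; have sS := stopped_sigma_algebraP st.
case: (st) => tau0 Ftau; have sF := filtration_sigma_algebra hF.
move: B; apply: (@emeasurable_sub _ [set B | stopped_sigma_algebra F tau (tau @^-1` B)]).
  case: (sS) => S0 SD SU; split=> [|A mA|A mA] /=.
  - by rewrite preimage_set0.
  - by rewrite setTD preimage_setC; exact: (sigma_algebra_setC sS).
  - by rewrite preimage_bigcup; exact: SU.
move=> r; split.
  rewrite -[X in measurable X]setTI; apply: stopping_time_measurable => //.
  rewrite (_ : mkset _ = `]r%:E, +oo[%classic); first exact: emeasurable_itv.
  by apply/seteqP; split=> x /=; rewrite in_itv/= andbT.
move=> t t0; have [r0|r0] := ltP r 0.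
  rewrite (_ : _ `&` _ = [set w | (tau w <= t%:E)%E]); first exact: Ftau.
  apply/seteqP; split=> w /= => [[]//|tw]; split => //.
  by apply: lt_le_trans (tau0 w); rewrite lte_fin.
have [rt|tr] := leP r t.
  rewrite (_ : _ `&` _ = [set w | (tau w <= t%:E)%E] `\`
      [set w | (tau w <= r%:E)%E]).
    apply: (sigma_algebra_setD (sF _ t0)); first exact: Ftau.
    by apply: (filtration_le hF r0 rt); exact: Ftau.
  by apply/seteqP; split=> w /= => [[h1 h2]|[h1 /negP h2]]; split=> //;
    rewrite ?ltNge//; apply/negP; rewrite -ltNge.
rewrite (_ : _ `&` _ = set0); first by case: (sF t t0).
apply/seteqP; split=> w //= [h1 h2]; have := lt_le_trans h1 h2.
by rewrite lte_fin ltNge (ltW tr).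
Qed.

Lemma stopped_lt (tau sig : T -> \bar R) : stopping_time F tau ->
  stopping_time F sig ->
  stopped_sigma_algebra F tau [set w | (tau w < sig w)%E].
Proof.
move=> st ss; have sF := filtration_sigma_algebra hF; split.
  rewrite -[X in measurable X]setTI.
  by apply: measurable_lte => //; exact: stopping_time_measurable.
case: st ss => tau0 Ftau [sig0 Fsig] t t0.
pose m (q : rat) : R := Num.min t `|ratr q|.
have m0 q : 0 <= m q by rewrite le_min t0/= normr_ge0.
have mt q : m q <= t by rewrite ge_min lexx.
rewrite (_ : _ `&` _ = \bigcup_q ([set w | (tau w <= (m q)%:E)%E] `\`
    [set w | (sig w <= (m q)%:E)%E])).
  apply: (sigma_algebra_bigcup_rat (sF _ t0)) => q.
  apply: (filtration_le hF (m0 q) (mt q)).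
  by apply: (sigma_algebra_setD (sF _ (m0 q))); [exact: Ftau|exact: Fsig].
apply/seteqP; split=> w /=; last first.
  move=> [q _ /= [h1 /negP]]; rewrite -ltNge => h2; split.
    exact: le_lt_trans h1 h2.
  by apply: le_trans h1 _; rewrite lee_fin.
move=> [ts tt].
have tfin : tau w \is a fin_num by rewrite ge0_fin_numE// (le_lt_trans tt)// ltry.
have [r r0 Er] : exists2 r : R, 0 <= r & tau w = r%:E.
  by exists (fine (tau w)); rewrite ?fineK// fine_ge0.
rewrite Er lee_fin in tt; rewrite Er in ts.
have [q rq qs] : exists2 q : rat, r < ratr q & ((ratr q : R)%:E < sig w)%E.
  case: (sig w) ts => [s|_|//].
    rewrite lte_fin => rs; have [q] := rat_in_itvoo rs.
    by rewrite in_itv/= => /andP[rq qs]; exists q => //; rewrite lte_fin.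
  have [q] := rat_in_itvoo (ltr_pwDr ltr01 (lexx r)).
  by rewrite in_itv/= => /andP[rq _]; exists q => //; rewrite ltry.
exists q => //=; rewrite Er lee_fin /m ger0_norm ?(le_trans r0 (ltW rq))//.
split; first by rewrite le_min tt ltW.
apply/negP; rewrite -ltNge; apply: le_lt_trans qs.
by rewrite lee_fin ge_min lexx orbT.
Qed.

End HittingEvents.

(** * Factorization of integrals under independence *)

Section ProductFormula.
Context {R : realType} {d : measure_display} {T : measurableType d}.
Local Open Scope ereal_scope.

Lemma integral_mrestr (mu : {measure set T -> \bar R}) (A : set T)
    (mA : measurable A) (g : T -> \bar R) :
  measurable_fun setT g -> (forall w, 0 <= g w) ->
  \int[mrestr mu mA]_w g w = \int[mu]_(w in A) g w.
Proof.
move=> mg g0.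
have mgA (B : set T) : measurable_fun B g by exact: measurable_funTS.
rewrite -(setUv A) (ge0_integral_setU _ mA (measurableC mA))//; last first.
  by apply/disj_setPS; rewrite setICr.
rewrite [X in _ + X]null_set_integral ?adde0//; last 2 first.
- exact: measurableC.
- by rewrite /= /mrestr setICl measure0.
by apply: eq_measure_integral => B mB BA; rewrite /= /mrestr setIidl.
Qed.

(** If, on the event [A], [h] is independent of [f] and distributed as [nu], then
    the integral of a product factorizes. *)
Lemma integral_mul_indep (P : probability T R) (A : set T) (mA : measurable A)
    (f h : T -> \bar R) (nu : probability (\bar R) R)
    (phi psi : \bar R -> \bar R) :
  measurable_fun setT f -> measurable_fun setT h ->
  measurable_fun setT phi -> measurable_fun setT psi ->
  (forall x, 0 <= phi x) -> (forall x, 0 <= psi x) ->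
  (forall B C, measurable B -> measurable C ->
    P (A `&` f @^-1` B `&` h @^-1` C) = P (A `&` f @^-1` B) * nu C) ->
  \int[P]_(w in A) (phi (f w) * psi (h w)) =
  (\int[P]_(w in A) phi (f w)) * \int[nu]_x psi x.
Proof.
move=> mf mh mphi mpsi phi0 psi0 indep.
have Afin : P A < +oo by rewrite ltey_eq fin_num_measure.
have pushE (g : T -> \bar R) (mg : measurable_fun setT g) :
    exists m : {finite_measure set (\bar R) -> \bar R},
      forall B, m B = P (g @^-1` B `&` A).
  pose m0 := (pushforward (mfrestr mA Afin) g : {measure set (\bar R) -> \bar R}).
  have fm0 : fin_num_fun (m0 mg).
    move=> B mB; rewrite /= /pushforward fin_num_measure//.
    by rewrite -[X in measurable X]setTI; exact: mg.
  pose m : {finite_measure set (\bar R) -> \bar R} :=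
    HB.pack (Measure.sort (m0 mg)) (Measure.class (m0 mg))
      (Measure_isFinite.Build _ _ _ (m0 mg) fm0).
  by exists m.
have [m1 m1E] := pushE f mf.
have mfh : measurable_fun setT (fun w => (f w, h w)) by exact: measurable_fun_pair.
pose m0 := (pushforward (mfrestr mA Afin) (fun w => (f w, h w)) :
  {measure set (\bar R * \bar R) -> \bar R}).
(* on A, the joint law of f and h is the product of the law m1 of f with nu *)
have prodE : forall B, measurable B -> (m1 \x nu) B = m0 mfh B.
  apply: product_measure_unique => B C mB mC.
  rewrite [LHS](_ : _ = P (A `&` f @^-1` B `&` h @^-1` C)).
    by rewrite indep//; congr (_ * _); rewrite setIC; exact/esym/m1E.
  by rewrite /= /pushforward /mfrestr /mrestr setIC; congr (P _); rewrite -setIA.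
have mpp : measurable_fun setT (fun z : \bar R * \bar R => phi z.1 * psi z.2).
  by apply: emeasurable_funM; [exact: measurableT_comp|exact: measurableT_comp].
have pp0 z : 0 <= phi z.1 * psi z.2 by rewrite mule_ge0.
rewrite -(@integral_mrestr P A mA (fun w => phi (f w) * psi (h w))); last 2 first.
- by apply: emeasurable_funM; exact: measurableT_comp.
- by move=> w; rewrite mule_ge0.
rewrite -(@ge0_integral_pushforward _ _ _ _ _ _ mfh (mrestr P mA) setT
  (fun z => phi z.1 * psi z.2))//.
rewrite [LHS](eq_measure_integral (m1 \x nu)); last first.
  by move=> B mB _; exact/esym/prodE.
rewrite fubini_tonelli1// /fubini_F /=.
under eq_integral => x _ do rewrite ge0_integralZl//.
rewrite ge0_integralZr//; last exact: integral_ge0.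
congr (_ * _).
rewrite -(@integral_mrestr P A mA (fun w => phi (f w)))//; last exact: measurableT_comp.
rewrite -(@ge0_integral_pushforward _ _ _ _ _ _ mf (mrestr P mA) setT phi)//.
by apply: eq_measure_integral => B mB _; exact: m1E.
Qed.
End ProductFormula.

(** * Discounting *)

Section Discount.
Context {R : realType}.
Implicit Types (x y : \bar R).

(** [discount x] is exp(- x) for finite [x], and 0 for infinite [x]. *)
Definition discount x : R := if x is r%:E then expR (- r) else 0.

Lemma discount_ge0 x : 0 <= discount x.
Proof. by case: x => //= r; exact: expR_ge0. Qed.

Lemma discount_le1 x : (0 <= x)%E -> discount x <= 1.
Proof.
by case: x => //= r; rewrite lee_fin => r0; rewrite -expR0 ler_expR oppr_le0.
Qed.

Lemma discount_lt1 x : (0 < x)%E -> discount x < 1.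
Proof.
case: x => //= r; rewrite lte_fin => r0; rewrite -expR0 ltr_expR oppr_lt0//.
Qed.

Lemma discountD x y : (0 <= x)%E -> (0 <= y)%E ->
  discount (x + y)%E = discount x * discount y.
Proof.
case: x y => [r| |] [s| |] //= _ _; rewrite ?mulr0 ?mul0r//.
by rewrite opprD expRD.
Qed.

Lemma le_discount x y : (0 <= x)%E -> (x <= y)%E -> discount y <= discount x.
Proof.
case: x y => [r| |] [s| |] //= r0; rewrite ?expR_ge0//.
by rewrite lee_fin => rs; rewrite ler_expR lerN2.
Qed.

Lemma measurable_discount : measurable_fun setT discount.
Proof.
pose D : set (\bar R) := [set x | x \is a fin_num].
have mD : measurable D.
  rewrite -[D]setTI.
  exact: (@emeasurable_fin_num _ _ R setT (@id (\bar R)) measurableT).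
rewrite (_ : discount = (fun x => \1_D x * expR (- fine x))).
  apply: measurable_funM; first exact: measurable_indic.
  apply: measurableT_comp; first exact: measurable_expR.
  by apply: measurableT_comp => //; exact: fine_measurable.
apply/funext => x; rewrite indicE; case: x => [r| |] /=.
- by rewrite mem_set ?mul1r.
- by rewrite memNset ?mul0r.
- by rewrite memNset ?mul0r.
Qed.

Lemma discount_gt x (y : R) : (0 <= x)%E -> 0 <= y -> y < discount x ->
  exists q : rat, (x < (ratr q)%:E)%E /\ y < expR (- ratr q).
Proof.
case: x => [r| |] //= _ y0 yr; last by move: (le_lt_trans y0 yr); rewrite ltxx.
have [z [z0 yz zr]] : exists z, [/\ 0 < z, y < z & z < expR (- r)].
  by exists ((y + expR (- r)) / 2); split; lra.
have rz : r < - ln z by rewrite ltrNr -ltr_expR lnK.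
have [q] := rat_in_itvoo rz; rewrite in_itv/= => /andP[rq qz]; exists q.
split; first by rewrite lte_fin.
apply: lt_trans yz _; rewrite -[ltLHS]lnK// ltr_expR; lra.
Qed.

Lemma discount_cvg (h : nat -> \bar R) x : (forall n, 0 <= h n)%E ->
  (forall n, h n <= x)%E ->
  (forall t : R, (t%:E < x)%E -> \forall n \near \oo, (t%:E < h n)%E) ->
  discount (h n) @[n --> \oo] --> discount x.
Proof.
move=> h0 hx H; apply/cvgrPdist_lt => e e0.
have x0 : (0 <= x)%E by apply: le_trans (h0 0%N) (hx 0%N).
have [t tx tr] : exists2 t : R, (t%:E < x)%E & expR (- t) < discount x + e.
  case: x x0 {hx H} => [r _|_|//] /=.
    exists (- ln (expR (- r) + e / 2)).
      rewrite lte_fin ltrNl -ltr_expR lnK ?ltrDl ?divr_gt0// posrE.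
      by rewrite addr_gt0 ?expR_gt0 ?divr_gt0.
    rewrite opprK lnK; first by rewrite ltrD2l; lra.
    by rewrite posrE addr_gt0 ?expR_gt0 ?divr_gt0.
  exists (- ln (e / 2)); first by rewrite ltry.
  by rewrite opprK lnK ?add0r; [lra|rewrite posrE divr_gt0].
have := H t tx; apply: filterS => n tn.
rewrite distrC ger0_norm ?subr_ge0 ?le_discount//.
rewrite ltrBlDl; apply: le_lt_trans tr.
case: (h n) tn => [r| |]//= tn; rewrite ?expR_ge0//.
by rewrite ler_expR lerN2 ltW.
Qed.

End Discount.

(** * The hitting times of a strong Markov process *)

Section Process.
Context {R : realType} (a b : \bar R) {d : measure_display}
  {Omega : measurableType d}.
Variables (F : R -> set (set Omega)) (P : \bar R -> probability Omega R)
  (X : R -> Omega -> \bar R).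
Hypotheses (hF : filtration F) (hX : strong_markov a b F P X)
  (hcont : continuous_up_to_death a b X).
Implicit Types (u v w z : R) (om : Omega).

Let tau z := hitting_time X z%:E.

Let tauE z om : tau z om = first_hit z%:E (X^~ om). Proof. by []. Qed.

Let path om : cpath (X^~ om).
Proof. exact: continuous_up_to_death_cpath hcont om. Qed.

Let tau_ge0 z om : (0 <= tau z om)%E. Proof. exact: first_hit_ge0. Qed.

Let tau_fin z om : (tau z om < +oo)%E -> (fine (tau z om))%:E = tau z om.
Proof. by move=> h; rewrite fineK// ge0_fin_numE. Qed.

Let X_tau z om : (tau z om < +oo)%E -> X (fine (tau z om)) om = z%:E.
Proof. exact: first_hit_attained (@path om). Qed.

Lemma hitting_time_stopping z : stopping_time F (tau z).
Proof.
split=> [om|t t0]; first exact: tau_ge0.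
rewrite (_ : mkset _ = [set om | forall n : nat, exists q : rat,
    `|contract (X (Num.min t `|ratr q|) om) - contract z%:E| < n.+1%:R^-1]).
  apply: (@sigma_algebra_approx_hit _ _ (F t) X _ _
    (filtration_sigma_algebra hF t0) t0).
  move=> s B /andP[s0 st] mB; apply: (filtration_le hF s0 st).
  exact: (strong_markov_adapted hX).
by apply/seteqP; split=> om /(first_hit_approxP _ (@path om) t0).
Qed.

Let mtau z : measurable_fun setT (tau z).
Proof. by apply: (stopping_time_measurable hF); exact: hitting_time_stopping. Qed.

Let mtau_pre z (B : set (\bar R)) : measurable B -> measurable (tau z @^-1` B).
Proof. by move=> mB; rewrite -[X in measurable X]setTI; exact: mtau. Qed.

Let E := state_space a b.

Let E_closed u : E u -> closed_state_space a b u%:E.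
Proof. by move=> Eu; apply: subset_closure; exists u. Qed.

Let mstart u : measurable [set om | X 0 om = u%:E].
Proof.
apply: (filtration_sub hF (lexx 0)).
have -> : [set om | X 0 om = u%:E] = X 0 @^-1` [set u%:E] by [].
by apply: (strong_markov_adapted hX).
Qed.

Lemma ae_start u (Q : Omega -> Prop) : E u ->
  (forall om, X 0 om = u%:E -> Q om) -> {ae P u%:E, forall om, Q om}.
Proof.
move=> Eu HQ; exists (~` [set om | X 0 om = u%:E]); split.
- exact: measurableC.
- rewrite probability_setC//= (strong_markov_start hX (E_closed Eu)) subee//.
- by move=> om /= nQ Xo; apply: nQ; exact: HQ.
Qed.

Lemma eq_start_prob u (A B : set Omega) : E u -> measurable A -> measurable B ->
  (forall om, X 0 om = u%:E -> A om <-> B om) -> P u%:E A = P u%:E B.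
Proof.
move=> Eu mA mB AB.
have H C : measurable C -> P u%:E C = P u%:E (C `&` [set om | X 0 om = u%:E]).
  move=> mC; rewrite -[in LHS](setIT C) -(setUv [set om | X 0 om = u%:E]) setIUr.
  rewrite measureU; [|exact: measurableI|by apply: measurableI => //; exact: measurableC
    |by rewrite setIACA setICr setI0].
  rewrite [X in (_ + X)%E](_ : _ = 0%E) ?adde0//.
  apply/eqP; rewrite eq_le measure_ge0 andbT.
  apply: (@le_trans _ _ (P u%:E (~` [set om | X 0 om = u%:E]))).
    by apply: le_measure; rewrite ?inE//; [apply: measurableI => //|]; exact: measurableC.
  by rewrite probability_setC//= (strong_markov_start hX (E_closed Eu)) subee.
rewrite H// [RHS]H//; congr (P _ _); apply/seteqP; split=> om [/= h1 h2];
  by split=> //; apply/(AB om h2).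
Qed.

(** On events of the past of [tau v] on which [tau v < tau w], the remaining time
    until [tau w] is independent of that past, with the law of [tau w] under
    [P v]. Written as a difference, it is visibly measurable. *)
Lemma strong_markov_hitting u v w (A : set Omega) (C : set (\bar R)) :
  E u -> E v -> stopped_sigma_algebra F (tau v) A ->
  (forall om, A om -> (tau v om < tau w om)%E) -> measurable C ->
  P u%:E (A `&` [set om | C (tau w om - tau v om)%E]) =
  (P u%:E A * P v%:E (tau w @^-1` C))%E.
Proof.
move=> Eu Ev FA Alt mC.
have [C' pC' HC'] := first_hit_path_event w%:E mC.
have := strong_markov_property hX (E_closed Eu) (hitting_time_stopping v) FA pC'.
have Afin om : A om -> (tau v om < +oo)%E.
  by move=> /Alt /lt_le_trans; apply; exact: leey.
have -> : A `&` [set om | (tau v om < +oo)%E] = A.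
  by apply/seteqP; split=> om /= => [[]//|Ao]; split=> //; exact: Afin.
rewrite (_ : A `&` [set om | C (tau w om - tau v om)%E] =
    A `&` [set om | C' (shift (fine (tau v om)) (X^~ om))]); last first.
  have E1 om : A om ->
      (tau w om - tau v om)%E = first_hit w%:E (shift (fine (tau v om)) (X^~ om)).
    move=> Aom; have vfin := Afin om Aom.
    have vw : ((fine (tau v om))%:E <= first_hit w%:E (X^~ om))%E.
      by rewrite tau_fin// ltW// -tauE Alt.
    rewrite [tau w om](first_hit_shift (fine_ge0 (tau_ge0 v om)) vw).
    by rewrite -[X in (_ + _ - X)%E](tau_fin vfin) addeAC subee// add0e.
  by apply/seteqP; split=> om [Aom /= H]; split=> //; move: H;
    rewrite E1// (HC' _ (cpath_shift (fine_ge0 (tau_ge0 v om)) (@path om))).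
move=> /= ->.
rewrite (eq_integral (cst (P v%:E (tau w @^-1` C)))) ?integral_cst//.
- by rewrite muleC.
- by case: FA.
move=> om; rewrite inE => Ao.
rewrite X_tau ?Afin//; congr (P _ _).
by apply/seteqP; split=> om' /= /(HC' _ (@path om')).
Qed.

Let K z om : \bar R := (discount (tau z om))%:E.

Let mK z (D : set Omega) : measurable_fun D (K z).
Proof.
apply: measurable_funTS; apply/measurable_EFinP.
by apply: measurableT_comp; [exact: measurable_discount|exact: mtau].
Qed.

Let K_ge0 z om : (0 <= K z om)%E.
Proof. by rewrite lee_fin discount_ge0. Qed.

Let K_le1 z om : (K z om <= 1)%E.
Proof. by rewrite lee_fin discount_le1. Qed.

(** The Laplace transform at 1 of the hitting time of [v] under [P u]. *)
Definition hitting_laplace u v : R := fine (\int[P u%:E]_om K v om)%E.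

Let L := hitting_laplace.

Let int_K_le u z (A : set Omega) : measurable A ->
  (\int[P u%:E]_(om in A) K z om <= P u%:E A)%E.
Proof.
move=> mA; rewrite -[leRHS]mul1e -integral_cst//.
by apply: ge0_le_integral.
Qed.

Let LE u v : (\int[P u%:E]_om K v om = (L u v)%:E)%E.
Proof.
rewrite fineK// ge0_fin_numE; last exact: integral_ge0.
by apply: le_lt_trans (int_K_le _ _ measurableT) _; rewrite probability_setT ltry.
Qed.

Let int1 u : (\int[P u%:E]_om 1 = 1)%E.
Proof. by rewrite integral_cst// mul1e; exact: probability_setT. Qed.

Let L_ge0 u v : 0 <= L u v.
Proof. by rewrite -lee_fin -LE integral_ge0. Qed.

Let L_le1 u v : L u v <= 1.
Proof.
rewrite -lee_fin -LE; apply: le_trans (int_K_le _ _ measurableT) _.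
by rewrite probability_setT.
Qed.

Lemma hitting_laplace_stopped u v w (A : set Omega) : E u -> E v ->
  stopped_sigma_algebra F (tau v) A ->
  (forall om, A om -> (tau v om < tau w om)%E) ->
  (\int[P u%:E]_(om in A) K w om =
   (\int[P u%:E]_(om in A) K v om) * (L v w)%:E)%E.
Proof.
move=> Eu Ev FA Alt; have mA : measurable A by case: FA.
pose tw : {mfun Omega >-> \bar R} :=
  HB.pack (tau w) (isMeasurableFun.Build _ _ _ _ _ (mtau w)).
pose nu := distribution (P v%:E) tw.
rewrite (eq_integral (fun om => (discount (tau v om))%:E *
    (discount (tau w om - tau v om)%E)%:E)%E); last first.
  move=> om; rewrite inE => Aom; rewrite /K -EFinM -discountD//; last first.
    by rewrite sube_ge0 ?ltW ?Alt// ge0_fin_numE// (lt_le_trans (Alt _ Aom)) ?leey.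
  congr (discount _)%:E; rewrite addeC subeK// ge0_fin_numE//.
  by rewrite (lt_le_trans (Alt _ Aom)) ?leey.
rewrite (@integral_mul_indep _ _ _ (P u%:E) A mA (tau v)
  (fun om => (tau w om - tau v om)%E) nu (EFin \o discount) (EFin \o discount)).
- congr (_ * _)%E; rewrite -LE ge0_integral_pushforward//.
    by apply/measurable_EFinP; exact: measurable_discount.
  by move=> x _; rewrite lee_fin discount_ge0.
- exact: mtau.
- by apply: emeasurable_funB; exact: mtau.
- by apply/measurable_EFinP; exact: measurable_discount.
- by apply/measurable_EFinP; exact: measurable_discount.
- by move=> x; rewrite lee_fin discount_ge0.
- by move=> x; rewrite lee_fin discount_ge0.
move=> B C mB mC; rewrite -(@strong_markov_hitting u v w)//.
  have sS := stopped_sigma_algebraP hF (hitting_time_stopping v).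
  apply: (sigma_algebra_setI sS) => //.
  by apply: stopped_preimage => //; exact: hitting_time_stopping.
by move=> om [/Alt].
Qed.

Let ae_start_eq u (f g : Omega -> \bar R) : E u ->
  measurable_fun setT f -> measurable_fun setT g ->
  (forall om, 0 <= f om)%E -> (forall om, 0 <= g om)%E ->
  (forall om, X 0 om = u%:E -> f om = g om) ->
  (\int[P u%:E]_om f om = \int[P u%:E]_om g om)%E.
Proof.
move=> Eu mf mg f0 g0 fg; apply: ge0_ae_eq_integral => //.
by apply: (ae_start (Q := fun om => setT om -> f om = g om) Eu) => om /fg.
Qed.

Let tau_between u v w om : X 0 om = u%:E -> (u <= v <= w) || (w <= v <= u) ->
  (tau v om <= tau w om)%E.
Proof. by move=> X0; exact: first_hit_between (@path om) X0. Qed.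

Let tau_eq v w om : v != w -> tau v om = tau w om -> tau v om = +oo%E.
Proof.
move=> vw e; apply/eqP; rewrite -leye_eq leNgt; apply/negP => h.
have h' : (tau w om < +oo)%E by rewrite -e.
have := X_tau h; rewrite e (X_tau h') => -[] /esym/eqP; exact/negP.
Qed.

(** From [u] to [w] one passes through [v], by continuity of the paths. *)
Lemma hitting_laplace_mul u v w : E u -> E v -> (u < v < w) || (w < v < u) ->
  L u w = L u v * L v w.
Proof.
move=> Eu Ev uvw; apply: EFin_inj; rewrite EFinM -!LE.
pose A := [set om | (tau v om < tau w om)%E].
have FA : stopped_sigma_algebra F (tau v) A.
  by apply: stopped_lt => //; exact: hitting_time_stopping.
have mA : measurable A by case: FA.
have vw : v != w by case/orP: uvw => /andP[? ?]; [rewrite lt_eqF|rewrite gt_eqF].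
have intA z : z = v \/ z = w ->
    (\int[P u%:E]_om K z om = \int[P u%:E]_(om in A) K z om)%E.
  move=> zvw; rewrite [RHS]integral_mkcond; apply: ae_start_eq => //.
  - by apply/(measurable_restrictT _ mA); exact: mK.
  - by move=> om; apply: erestrict_ge0 => ? _; exact: K_ge0.
  move=> om X0; rewrite patchE; case: ifPn => // /negP; rewrite inE => nA.
  have vw' : (tau v om <= tau w om)%E.
    by apply: (@tau_between u) => //; lra.
  have e : tau v om = tau w om.
    by apply/eqP; rewrite eq_le vw' leNgt; exact/negP.
  have ve := tau_eq vw e.
  by case: zvw => ->; rewrite /K -?e ve.
rewrite (intA w); last by right.
rewrite (intA v); last by left.
by rewrite (@hitting_laplace_stopped u v w A)// LE.
Qed.

Lemma hitting_laplace_refl u : E u -> L u u = 1.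
Proof.
move=> Eu; apply: EFin_inj; rewrite -LE.
rewrite (@ae_start_eq u _ (cst 1%E))//; last first.
  move=> om X0; rewrite /K; suff -> : tau u om = 0%E by rewrite /= oppr0 expR0.
  by apply/eqP; rewrite eq_le tau_ge0 andbT; exact: first_hit_le X0.
Qed.

Lemma hitting_laplace_lt1 u v : E u -> u != v -> L u v < 1.
Proof.
move=> Eu uv; rewrite lt_neqAle L_le1 andbT; apply/eqP => L1.
have mf : measurable_fun setT (fun om => 1 - K v om)%E.
  by apply: emeasurable_funB => //; exact: mK.
have f0 om : (0 <= 1 - K v om)%E by rewrite sube_ge0.
have int0 : (\int[P u%:E]_om `|1 - K v om| = 0)%E.
  under eq_integral => om _ do rewrite gee0_abs//.
  have := @ge0_integralD _ _ _ (P u%:E) _ measurableT (fun om => 1 - K v om)%E (K v).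
  move=> /(_ (fun om _ => f0 om) mf (fun om _ => K_ge0 v om) (@mK v setT)).
  under eq_integral => om _ do rewrite subeK//.
  rewrite int1 LE L1; move: (integral _ _ _) => [r| |]//= [] e.
  by congr EFin; lra.
have /(ae_eq_integral_abs (P u%:E) measurableT mf).1 := int0.
move=> ae0.
have ae1 : {ae P u%:E, forall om, 1 - K v om != 0}%E.
  apply: ae_start => // om X0; apply/eqP => /eqP.
  rewrite sube_eq ?fin_numE// ?add0e => /eqP[] e.
  have : (0 < tau v om)%E.
    by apply: first_hit_gt0; [exact: path|rewrite X0 => -[]; exact/eqP].
  by move=> /discount_lt1; rewrite -e ltxx.
have : {ae P u%:E, forall om : Omega, False}.
  move: ae0 ae1; apply: filterS2 => om /= /(_ I) -> /eqP; exact.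
move=> [N [mN N0 NT]].
have : P u%:E setT = 0%E.
  by apply/eqP; rewrite eq_le measure_ge0 andbT -N0 le_measure ?inE// => om _; exact: NT.
by rewrite probability_setT => /eqP; rewrite onee_eq0.
Qed.

Lemma hitting_laplace_gt0 u v : (0 < P u%:E [set om | (tau v om < +oo)%E])%E ->
  0 < L u v.
Proof.
move=> H; rewrite lt_neqAle L_ge0 andbT eq_sym; apply/eqP => L0.
have : (\int[P u%:E]_om `|K v om| = 0)%E.
  by under eq_integral => om _ do rewrite gee0_abs//; rewrite LE L0.
move=> /(ae_eq_integral_abs (P u%:E) measurableT (@mK v setT)).1 [N [mN N0 KN]].
have : (P u%:E [set om | (tau v om < +oo)%E] <= P u%:E N)%E.
  apply: le_measure; rewrite ?inE//.
    rewrite (_ : mkset _ = tau v @^-1` [set x | (x < +oo)%E])//; apply: mtau_pre.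
    rewrite (_ : mkset _ = [set` `]-oo, +oo%E[]); first exact: emeasurable_itv.
    by apply/seteqP; split=> x /=; rewrite in_itv.
  move=> om /= h; apply: KN => /= /(_ I) [].
  by rewrite -(tau_fin h) /= => /eqP; rewrite expR_eq0.
by rewrite N0 leNgt H.
Qed.
Let mlt z (t : \bar R) : measurable [set om | (tau z om < t)%E].
Proof.
rewrite (_ : mkset _ = tau z @^-1` [set` `]-oo, t[]).
  by apply: mtau_pre; exact: emeasurable_itv.
by apply/seteqP; split=> om /=; rewrite in_itv.
Qed.

(** exp(- t) for t the essential infimum of the hitting time of [v] under
    [P u]; it is 0 if [v] is almost surely never hit. *)
Definition hitting_best u v : R :=
  sup [set expR (- t) | t in [set t | 0 < P u%:E [set om | tau v om < t%:E]]%E].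

Let g := hitting_best.

Let Pgt0_pos u v t : (0 < P u%:E [set om | tau v om < t%:E])%E -> 0 < t.
Proof.
apply: contraTT; rewrite -!leNgt => t0.
rewrite (_ : mkset _ = set0) ?measure0//; apply/seteqP; split=> om //= h.
by have := le_lt_trans (tau_ge0 v om) h; rewrite lte_fin ltNge t0.
Qed.

Let g_ub u v t : (0 < P u%:E [set om | tau v om < t%:E])%E -> expR (- t) <= g u v.
Proof.
move=> H; apply: ub_le_sup; last by exists t.
by exists 1 => _ [s /Pgt0_pos s0 <-]; rewrite -expR0 ler_expR oppr_le0 ltW.
Qed.

Let g_ge0 u v : 0 <= g u v.
Proof.
have [S0|/set0P[_ [t Pt _]]] := eqVneq [set expR (- t) | t in
    [set t | 0 < P u%:E [set om | tau v om < t%:E]]%E] set0.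
  by rewrite /g /hitting_best S0 sup0.
exact: le_trans (expR_ge0 _) (g_ub Pt).
Qed.

Lemma hitting_best_le1 u v : g u v <= 1.
Proof.
have [S0|/set0P S0] := eqVneq [set expR (- t) | t in
    [set t | 0 < P u%:E [set om | tau v om < t%:E]]%E] set0.
  by rewrite /g /hitting_best S0 sup0.
apply: ge_sup => // _ [t /Pgt0_pos t0 <-].
by rewrite -expR0 ler_expR oppr_le0 ltW.
Qed.

Lemma ae_discount_le_best u v :
  {ae P u%:E, forall om, discount (tau v om) <= g u v}.
Proof.
pose S (q : rat) := [set om | (tau v om < (ratr q)%:E)%E].
pose N n : set Omega := if unpickle n is Some q then
  (if P u%:E (S q) == 0%E then S q else set0) else set0.
have : (P u%:E).-negligible (\bigcup_n N n).
  apply: negligible_bigcup => n; rewrite /N.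
  case: (unpickle n) => [q|]; last exact: negligible_set0.
  case: eqP => [q0|_]; last exact: negligible_set0.
  by exists (S q); split => //; exact: mlt.
apply: negligibleS => om /= /negP; rewrite -ltNge => h.
have [q [tq gq]] := discount_gt (tau_ge0 v om) (g_ge0 u v) h.
exists (pickle q); first exact: I.
rewrite /N pickleK ifT//.
apply/eqP; apply/eqP; rewrite eq_le measure_ge0 andbT leNgt; apply/negP => Pq.
by have := g_ub Pq; rewrite leNgt gq.
Qed.

Let int_K_le_g u v (A : set Omega) : measurable A ->
  (\int[P u%:E]_(om in A) K v om <= (g u v)%:E * P u%:E A)%E.
Proof.
move=> mA; rewrite -integral_cst//; apply: ae_ge0_le_integral => //.
- by move=> om _; rewrite lee_fin.
- have := ae_discount_le_best u v; apply: filterS => om h _.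
  by rewrite lee_fin.
Qed.

Lemma hitting_laplace_le_best u v : L u v <= g u v.
Proof.
rewrite -lee_fin -LE; apply: le_trans (int_K_le_g _ _ measurableT) _.
by rewrite probability_setT mule1.
Qed.

(** The probability of hitting [v] strictly before [w], starting from [u]. *)
Definition hitting_before u v w : R :=
  fine (P u%:E [set om | (tau v om < tau w om)%E]).

Let mbefore v w : measurable [set om | (tau v om < tau w om)%E].
Proof.
rewrite -[X in measurable X]setTI.
by apply: measurable_lte => //; exact: mtau.
Qed.

Let beforeE u v w : P u%:E [set om | (tau v om < tau w om)%E] =
  (hitting_before u v w)%:E.
Proof. by rewrite fineK// fin_num_measure. Qed.

Lemma hitting_before_ge0 u v w : 0 <= hitting_before u v w.
Proof. by rewrite fine_ge0. Qed.

Lemma hitting_before_le1 u v w : hitting_before u v w + hitting_before u w v <= 1.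
Proof.
rewrite -lee_fin EFinD -!beforeE -measureU//.
  by apply: probability_le1; exact: measurableU.
apply/seteqP; split=> om //= [h1 h2]; have := lt_trans h1 h2.
by rewrite ltxx.
Qed.

(** Decomposition according to which of [u] and [w] is hit first: if it is [w],
    the discount is at most [hitting_best v w]; if it is [u], the motion starts
    afresh there. *)
Lemma hitting_laplace_exit u v w : E u -> E v -> u != w ->
  L v w <= hitting_before v w u * g v w + hitting_before v u w * L u w.
Proof.
move=> Eu Ev uw.
pose A := [set om | (tau w om < tau u om)%E].
pose B := [set om | (tau u om < tau w om)%E].
have mA : measurable A by exact: mbefore.
have mB : measurable B by exact: mbefore.
have mKr (C : set Omega) : measurable C -> measurable_fun setT (K w \_ C).
  by move=> mC; apply/(measurable_restrictT _ mC); exact: mK.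
have Kr0 C om : (0 <= (K w \_ C) om)%E.
  by apply: erestrict_ge0 => ? _; exact: K_ge0.
rewrite -lee_fin EFinD !EFinM -LE.
rewrite (eq_integral (fun om => (K w \_ A) om + (K w \_ B) om)%E); last first.
  move=> om _; rewrite !patchE.
  have [h|h|h] := ltgtP (tau w om) (tau u om).
  - by rewrite mem_set// memNset ?adde0// /B/= ltNge (ltW h).
  - by rewrite memNset ?mem_set ?add0e// /A/= ltNge (ltW h).
  - rewrite !memNset ?adde0; [|by rewrite /B/= h ltxx|by rewrite /A/= h ltxx].
    by rewrite /K h (tau_eq uw).
rewrite ge0_integralD//; [|exact: mKr|exact: mKr].
rewrite -!integral_mkcond leeD//.
  by rewrite muleC -beforeE int_K_le_g.
rewrite (@hitting_laplace_stopped v u w B)//; last first.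
  by apply: stopped_lt => //; exact: hitting_time_stopping.
apply: lee_wpmul2r; first by rewrite lee_fin.
by rewrite -beforeE int_K_le.
Qed.

Let diff_lt_measurable v w (t : \bar R) :
  measurable [set om | (tau w om - tau v om < t)%E].
Proof.
have mf : measurable_fun setT (fun om => (tau w om - tau v om)%E).
  by apply: emeasurable_funB; exact: mtau.
rewrite (_ : mkset _ = setT `&` (fun om => (tau w om - tau v om)%E) @^-1`
    [set` `]-oo, t[]); first by apply: mf => //; exact: emeasurable_itv.
by apply/seteqP; split=> om /=; rewrite in_itv// => -[].
Qed.

Lemma hitting_time_lt_add u v w (s t : R) : E u -> E v ->
  (u < v < w) || (w < v < u) ->
  (0 < P u%:E [set om | tau v om < s%:E])%E ->
  (0 < P v%:E [set om | tau w om < t%:E])%E ->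
  (0 < P u%:E [set om | tau w om < (s + t)%:E])%E.
Proof.
move=> Eu Ev uvw Ps Pt.
have vw : v != w by case/orP: uvw => /andP[? ?]; [rewrite lt_eqF|rewrite gt_eqF].
pose A := [set om | (tau v om < s%:E)%E] `&` [set om | (tau v om < tau w om)%E].
have sv := hitting_time_stopping v.
have FA : stopped_sigma_algebra F (tau v) A.
  apply: (sigma_algebra_setI (stopped_sigma_algebraP hF sv)).
    rewrite (_ : mkset _ = tau v @^-1` [set` `]-oo, s%:E[]).
      by apply: stopped_preimage => //; exact: emeasurable_itv.
    by apply/seteqP; split=> om /=; rewrite in_itv.
  by apply: stopped_lt => //; exact: hitting_time_stopping.
have mA : measurable A by case: FA.
have PA : P u%:E A = P u%:E [set om | (tau v om < s%:E)%E].
  apply: eq_start_prob => // om X0; split=> [[]//|/= h]; split=> //=.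
  rewrite lt_neqAle (@tau_between u)// ?andbT; last lra.
  apply/eqP => /(tau_eq vw) voo; move: h; rewrite voo ltNge leey//.
have mC : measurable [set x : \bar R | (x < t%:E)%E].
  rewrite (_ : mkset _ = [set` `]-oo, t%:E[]); first exact: emeasurable_itv.
  by apply/seteqP; split=> x /=; rewrite in_itv.
have := @strong_markov_hitting u v w A _ Eu Ev FA (fun om h => h.2) mC.
rewrite PA => H.
have : (0 < P u%:E (A `&` [set om | tau w om - tau v om < t%:E]))%E.
  by rewrite H mule_gt0.
move=> /lt_le_trans; apply; apply: le_measure; rewrite ?inE.
- by apply: measurableI => //; exact: diff_lt_measurable.
- exact: mlt.
move=> om [[/= h1 h2]] h3.
have vfin : (tau v om < +oo)%E by rewrite (lt_le_trans h1)// leey.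
move: h1 h3; rewrite /= -(tau_fin vfin).
move: (tau w om) (fine (tau v om)) => [r| |] q //=; last by move=> _ _; exact: ltNyr.
rewrite -EFinB !lte_fin.
by move=> h1 h3; rewrite (addrC s) -[r](subrK q) ltrD.
Qed.
Lemma hitting_best_mul u v w : E u -> E v -> (u < v < w) || (w < v < u) ->
  g u v * g v w <= g u w.
Proof.
move=> Eu Ev uvw.
have [->|gvw] := eqVneq (g v w) 0; first by rewrite mulr0.
have {}gvw : 0 < g v w by rewrite lt_neqAle eq_sym gvw g_ge0.
have guw := g_ge0 u w.
rewrite -ler_pdivlMr//.
have [S0|/set0P S0] := eqVneq [set expR (- t) | t in
    [set t | 0 < P u%:E [set om | tau v om < t%:E]]%E] set0.
  by rewrite {1}/g /hitting_best S0 sup0 divr_ge0.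
apply: ge_sup => // _ [s Ps <-].
rewrite ler_pdivlMr// mulrC -ler_pdivlMr ?expR_gt0//.
have [S1|/set0P S1] := eqVneq [set expR (- t) | t in
    [set t | 0 < P v%:E [set om | tau w om < t%:E]]%E] set0.
  by rewrite {1}/g /hitting_best S1 sup0 divr_ge0// expR_ge0.
apply: ge_sup => // _ [t Pt <-].
rewrite ler_pdivlMr ?expR_gt0// mulrC -expRD -opprD; apply: g_ub.
exact: hitting_time_lt_add uvw Ps Pt.
Qed.

(** When [vn] tends to [v] from the side of the starting point, the hitting times
    of [vn] are below the hitting time of [v] and converge to it. *)
Lemma hitting_laplace_cvg u v (vn : nat -> R) : E u ->
  vn n @[n --> \oo] --> v ->
  (forall n, (u < vn n < v) || (v < vn n < u)) ->
  L u (vn n) @[n --> \oo] --> L u v.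
Proof.
move=> Eu vn_v bet.
suff : (\int[P u%:E]_om K (vn n) om)%E @[n --> \oo] -->
    (\int[P u%:E]_om K v om)%E.
  rewrite LE => /fine_cvg; apply: cvg_trans.
  by apply: near_eq_cvg; near=> n; rewrite /= LE.
have [] // := @dominated_convergence _ _ _ (P u%:E) setT measurableT
  (fun n => K (vn n)) (K v) (cst 1%E).
- apply: (ae_start (Q := fun om => setT om ->
    K (vn n) om @[n --> \oo] --> K v om) Eu) => om X0 _.
  apply/fine_cvgP; split; first by near=> n.
  apply: discount_cvg => [n|n|t tv].
  + exact: tau_ge0.
  + by apply: (@tau_between u) => //; have := bet n; lra.
  + have := first_hit_near (@path om) tv => H.
    exact: vn_v H.
- by apply/integrableP; split => //; under eq_integral do rewrite abse1; rewrite int1 ltry.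
- apply: aeW => om n _; by rewrite gee0_abs.
Unshelve. all: by end_near. Qed.

Hypothesis hreg : regular a b P X.

Lemma hitting_laplace_pos u v : E u -> E v -> 0 < L u v.
Proof. by move=> Eu Ev; apply: hitting_laplace_gt0; exact: hreg. Qed.

(** As [L u v = L u y * L y v], with [L u y] close to the positive number [L u v]
    when [y] approaches [v] from the side of [u]. *)
Lemma hitting_laplace_near u v eta : E u -> E v -> u != v -> 0 < eta ->
  exists2 del : R, 0 < del & forall y, (u < y < v) || (v < y < u) ->
    `|v - y| < del -> 1 - eta < L y v.
Proof.
move=> Eu Ev uv eta0; apply: contrapT => H.
have /choice[vn Hvn] : forall n : nat, exists y,
    [/\ (u < y < v) || (v < y < u), `|v - y| < n.+1%:R^-1 & L y v <= 1 - eta].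
  move=> n; apply: contrapT => nex; apply: H; exists n.+1%:R^-1 => //.
  move=> y hy vy; rewrite ltNge; apply/negP => Ly; apply: nex; by exists y.
have vn_v : vn n @[n --> \oo] --> v.
  apply/cvgrPdist_lt => e e0.
  have := near_infty_natSinv_lt (PosNum e0); apply: filterS => n /= ne.
  by apply: lt_trans ne; case: (Hvn n).
have bet n : (u < vn n < v) || (v < vn n < u) by case: (Hvn n).
have Lcv := hitting_laplace_cvg Eu vn_v bet.
have Luv := hitting_laplace_pos Eu Ev.
have Evn n : E (vn n).
  case: Eu Ev => au ub [av vb]; case/orP: (bet n) => /andP[h1 h2]; split.
  - by apply: lt_trans au _; rewrite lte_fin.
  - by apply: lt_trans vb; rewrite lte_fin.
  - by apply: lt_trans av _; rewrite lte_fin.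
  - by apply: lt_trans ub; rewrite lte_fin.
have Lle n : L u v <= L u (vn n) * (1 - eta).
  rewrite (@hitting_laplace_mul u (vn n) v)//.
  by apply: ler_wpM2l; [exact: L_ge0|case: (Hvn n)].
have Lcv' : L u (vn n) * (1 - eta) @[n --> \oo] --> L u v * (1 - eta).
  by apply: cvgM => //; exact: cvg_cst.
have : L u v <= L u v * (1 - eta).
  by apply: (ler_cvg_to (cvg_cst _) Lcv'); near=> n; exact: Lle.
by rewrite mulrBr mulr1 lerDl oppr_ge0 leNgt mulr_gt0.
Unshelve. all: by end_near. Qed.

Let E_between u v y : E u -> E v -> u <= y <= v -> E y.
Proof.
move=> [au _] [_ vb] /andP[uy yv]; split.
  by apply: lt_le_trans au _; rewrite lee_fin.
by apply: le_lt_trans vb; rewrite lee_fin.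
Qed.

Let E_above v : E v -> exists2 w, v < w & E w.
Proof.
move=> [av vb]; have [w vw wb] : exists2 w, v < w & (w%:E < b)%E.
  case: b vb => [r| |//]; last by exists (v + 1); rewrite ?ltrDl ?ltry.
  by rewrite lte_fin => vr; exists ((v + r) / 2); rewrite ?lte_fin; lra.
by exists w => //; split=> //; apply: lt_trans av _; rewrite lte_fin.
Qed.

Let E_below v : E v -> exists2 w, w < v & E w.
Proof.
move=> [av vb]; have [w wv aw] : exists2 w, w < v & (a < w%:E)%E.
  case: a av => [r| |]//; last by exists (v - 1); rewrite ?ltNyr// gtrBl.
  by rewrite lte_fin => vr; exists ((v + r) / 2); rewrite ?lte_fin; lra.
by exists w => //; split=> //; apply: lt_trans vb; rewrite lte_fin.
Qed.

(* The choice of f decides between upward and downward motion. *)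
Let best_eq1_along (f : R -> R) x y z : f = id \/ f = -%R -> E (f x) -> E (f z) ->
  x <= y -> y < z -> g (f x) (f y) = 1.
Proof.
move=> Hf Ex Ez.
have Ef p : x <= p <= z -> E (f p).
  move=> xpz; case: Hf Ex Ez => -> /= Ex Ez; first exact: (E_between Ex Ez).
  by apply: (E_between Ez Ex); rewrite !lerN2 andbC.
have f_between p q r : p < q -> q < r -> (f p < f q < f r) || (f r < f q < f p).
  by move=> pq qr; case: Hf => -> /=; rewrite ?ltrN2 pq qr ?orbT.
have f_dist p q : `|f p - f q| = `|p - q|.
  by case: Hf => -> //=; rewrite -opprD normrN.
have f_neq p q : p != q -> f p != f q.
  by case: Hf => -> //=; rewrite eqr_opp.
apply: (@two_point_eq1 R (fun p q => L (f p) (f q)) (fun p q => g (f p) (f q)) x z).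
- by move=> p q hp hq; apply: hitting_laplace_pos; exact: Ef.
- by move=> p q _ _; exact: hitting_laplace_le_best.
- by move=> p q _ _; exact: hitting_best_le1.
- by move=> p hp; apply: hitting_laplace_refl; exact: Ef.
- by move=> p q hp _ pq; apply: hitting_laplace_lt1; [exact: Ef|exact: f_neq].
- move=> p q r xp pq qr rz; apply: hitting_laplace_mul; last exact: f_between.
    by apply: Ef; lra.
  by apply: Ef; lra.
- move=> p q r xp pq qr rz; apply: hitting_laplace_mul.
  + by apply: Ef; lra.
  + by apply: Ef; lra.
  + by rewrite orbC f_between.
- move=> p q r xp pq qr rz; apply: hitting_best_mul; last exact: f_between.
    by apply: Ef; lra.
  by apply: Ef; lra.
- move=> p q r xp pq qr rz.
  have Ep : E (f p) by apply: Ef; lra.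
  have Eq : E (f q) by apply: Ef; lra.
  have Er : E (f r) by apply: Ef; lra.
  have pr : f p != f r by apply: f_neq; rewrite lt_eqF// (lt_trans pq).
  exists (hitting_before (f q) (f r) (f p)), (hitting_before (f q) (f p) (f r)).
  split; [exact: hitting_before_ge0|exact: hitting_before_ge0|
    exact: hitting_before_le1|exact: hitting_laplace_exit|].
  apply: (le_trans (hitting_laplace_exit Er Eq _)); first by rewrite eq_sym.
  rewrite lerD2r -[leRHS]mulr1 ler_wpM2l//; first exact: hitting_before_ge0.
  exact: hitting_best_le1.
- move=> p eta xp pz eta0.
  have Ep : E (f p) by apply: Ef; lra.
  have xp' : f x != f p by apply: f_neq; rewrite lt_eqF.
  have [del del0 H] := hitting_laplace_near Ex Ep xp' eta0.
  exists (Num.min del (p - x)); first by rewrite lt_min del0 subr_gt0.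
  have m1 : Num.min del (p - x) <= del by rewrite ge_min lexx.
  have m2 : Num.min del (p - x) <= p - x by rewrite ge_min lexx orbT.
  move=> q xq pq qp; apply: H; first by apply: f_between => //; lra.
  by rewrite f_dist ger0_norm; lra.
- move=> p eta xp pz eta0.
  have Ep : E (f p) by apply: Ef; lra.
  have zp : f z != f p by apply: f_neq; rewrite gt_eqF.
  have [del del0 H] := hitting_laplace_near Ez Ep zp eta0.
  exists (Num.min del (z - p)); first by rewrite lt_min del0 subr_gt0.
  have m1 : Num.min del (z - p) <= del by rewrite ge_min lexx.
  have m2 : Num.min del (z - p) <= z - p by rewrite ge_min lexx orbT.
  move=> q qz qp pq; apply: H; first by rewrite orbC; apply: f_between => //; lra.
  by rewrite f_dist ler0_norm; lra.
Qed.

Lemma hitting_best_eq1 u v : E u -> E v -> g u v = 1.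
Proof.
move=> Eu Ev; have [uv|uv] := leP u v.
  have [w vw Ew] := E_above Ev.
  exact: (@best_eq1_along id u v w (or_introl erefl)).
have [w wv Ew] := E_below Ev.
have := @best_eq1_along -%R (- u) (- v) (- w) (or_intror erefl).
by rewrite !opprK lerN2 ltrN2; apply => //; exact: ltW.
Qed.

Theorem hitting_time_lt_pos u v (eps : R) : E u -> E v -> 0 < eps ->
  (0 < P u%:E [set om | tau v om < eps%:E])%E.
Proof.
move=> Eu Ev eps0.
have g1 := hitting_best_eq1 Eu Ev.
have S0 : [set expR (- t) | t in
    [set t | 0 < P u%:E [set om | tau v om < t%:E]]%E] !=set0.
  apply/set0P/eqP => S0; move: g1; rewrite /g /hitting_best S0 sup0 => /eqP.
  by rewrite eq_sym oner_eq0.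
have eps1 : 0 < 1 - expR (- eps).
  by rewrite subr_gt0 -expR0 ltr_expR oppr_lt0.
have hS : has_sup [set expR (- t) | t in
    [set t | 0 < P u%:E [set om | tau v om < t%:E]]%E].
  split => //; exists 1 => _ [s /Pgt0_pos s0 <-].
  by rewrite -expR0 ler_expR oppr_le0 ltW.
have [_ [t Pt <-]] := sup_adherent eps1 hS.
rewrite -/(hitting_best u v) -/g g1 opprB addrC subrK ltr_expR ltrN2 => te.
apply: lt_le_trans Pt _; apply: le_measure; rewrite ?inE.
- exact: mlt.
- exact: mlt.
- by move=> om /= h; apply: lt_trans h _; rewrite lte_fin.
Qed.
End Process.

Theorem theorem1 (R : realType) (a b : \bar R) (hab : (a < b)%E)
    (d : measure_display) (Omega : measurableType d)
    (F : R -> set (set Omega)) (P : \bar R -> probability Omega R)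
    (X : R -> Omega -> \bar R)
    (hF : filtration F)
    (hX : strong_markov a b F P X)
    (hcont : continuous_up_to_death a b X)
    (hreg : regular a b P X)
    (xi z : R) (hxi : state_space a b xi) (hz : state_space a b z)
    (eps : R) (heps : 0 < eps) :
  (0 < P xi%:E [set w | hitting_time X z%:E w < eps%:E])%E.
Proof. exact: (hitting_time_lt_pos hF hX hcont hreg hxi hz heps). Qed.
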